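(* The Lie algebra $\mathfrak{sl}(4,\mathbb{R})$ does not admit an overalgebra almost separating of degree $3$.
   Context: Let $G=SL(4,\mathbb{R})$, $\mathfrak g=\mathfrak{sl}(4,\mathbb{R})$; $\mathfrak g^\star$ is identified with $\mathfrak g$ by the invariant form $\langle X,Y\rangle=\mathrm{Tr}(XY)$, so that the coadjoint action $\mathrm{Coad}$ becomes conjugation. An element $\xi\in\mathfrak g^\star=\mathfrak{sl}(4,\mathbb{R})$ is called generic if it belongs to $\Omega=\{\xi\in\mathfrak{sl}(4,\mathbb{R}) : \xi \text{ has } 4 \text{ distinct complex eigenvalues}\}$. Given a finite-dimensional real linear representation $(\pi,V)$ of $G$, let $G^+=G\rtimes V$ be the Lie group with underlying set $G\times V$ and law $(g,v)(g',v')=(gg',v+\pi(g)v')$. Its Lie algebra is $\mathfrak g^+=\mathfrak g\rtimes V$, with bracket $[(X,u),(X',u')]=([X,X'],\pi'(X)u'-\pi'(X')u)$, where $\pi'$ is the derivative of $\pi$. One identifies $(\mathfrak g^+)^\star$ with $\mathfrak g^\star\oplus V^\star$. Let $p:(\mathfrak g^+)^\star\to\mathfrak g^\star$ be the canonical projection. An overalgebra almost separating of degree $d$ of $\mathfrak g$ is a pair $(\mathfrak g^+,\phi)$ where $\mathfrak g^+=\mathfrak g\rtimes V$ is the Lie algebra, with bracket $[(X,u),(X',u')]=([X,X'],\pi'(X)u'-\pi'(X')u)$, of the Lie group $G^+=G\rtimes V$ associated with some finite-dimensional real linear representation $(\pi,V)$ of $G$, and $\phi:\mathfrak g^\star\to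 V^\star$ is a polynomial map of degree $d$, such that the map $\Phi:\mathfrak g^\star\to(\mathfrak g^+)^\star$, $\Phi(\xi)=(\xi,\phi(\xi))$ (so $p\circ\Phi=\mathrm{id}$) satisfies: (i) $\Phi(\mathrm{Coad}(G)\xi)=\mathrm{Coad}(G^+)\Phi(\xi)$ for every $\xi\in\mathfrak g^\star$; (ii) for every generic $\xi$, the set of coadjoint orbits $\mathrm{Coad}(G)\xi'$, $\xi'\in\mathfrak g^\star$, such that $\overline{\mathrm{Conv}}\big(\Phi(\mathrm{Coad}(G)\xi')\big)=\overline{\mathrm{Conv}}\big(\Phi(\mathrm{Coad}(G)\xi)\big)$ is finite. Here $\overline{\mathrm{Conv}}$ denotes the closed convex hull. *)

(* Defs.v *)
From HB Require Import structures.
From mathcomp Require Import all_boot all_order all_algebra.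
From mathcomp Require Import all_classical all_reals all_analysis.
From mathcomp Require Import complex.
From mathcomp Require mpoly.
(* The notations of mpoly clash with those of mathcomp-analysis. *)
Import -(notations) mpoly.

Set Implicit Arguments.
Unset Strict Implicit.
Unset Printing Implicit Defensive.
Import Order.TTheory GRing.Theory Num.Theory.
Import numFieldNormedType.Exports.

Local Open Scope classical_set_scope.
Local Open Scope ring_scope.

Definition SL4 (R : realType) : set 'M[R]_4 := [set g | \det g = 1].

(* Also stands for the dual of sl(4,R), a matrix xi being the linear form
   X |-> \tr (xi *m X). *)
Definition sl4 (R : realType) : set 'M[R]_4 := [set X | \tr X = 0].

Definition coad_orbit (R : realType) (xi : 'M[R]_4) : set 'M[R]_4 :=
  [set g *m xi *m invmx g | g in @SL4 R].

Definition generic (R : realType) (xi : 'M[R]_4) : Prop :=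
  sl4 xi /\
  exists s : seq R[i], [/\ size s = 4%N, uniq s &
    forall z, z \in s -> eigenvalue (map_mx (real_complex R) xi) z].

(* Representations are on column vectors, in coordinates; the values of rho
   outside SL4 are irrelevant. *)
Definition is_representation (R : realType) (n : nat)
    (rho : 'M[R]_4 -> 'M[R]_n) : Prop :=
  [/\ rho 1%:M = 1%:M,
      forall g h, SL4 g -> SL4 h -> rho (g *m h) = rho g *m rho h &
      {within @SL4 R, continuous rho}].

Definition gplus (R : realType) (n : nat) : set ('M[R]_4 * 'cV[R]_n) :=
  [set x | SL4 x.1].

Definition gplus_mul (R : realType) (n : nat) (rho : 'M[R]_4 -> 'M[R]_n)
    (x y : 'M[R]_4 * 'cV[R]_n) : 'M[R]_4 * 'cV[R]_n :=
  (x.1 *m y.1, x.2 + rho x.1 *m y.2).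

Definition gplus_inv (R : realType) (n : nat) (rho : 'M[R]_4 -> 'M[R]_n)
    (x : 'M[R]_4 * 'cV[R]_n) : 'M[R]_4 * 'cV[R]_n :=
  (invmx x.1, - (rho (invmx x.1) *m x.2)).

Definition expmx (R : realType) (X : 'M[R]_4) : 'M[R]_4 :=
  limn (series (fun k => (k`!%:R)^-1 *: X ^+ k)).

(* The differential at the identity of conjugation by x in G+, computed along
   the curve t |-> (exp (t X), t u), whose velocity at 0 is Y = (X, u). In
   closed form it is
     (g X g^-1, rho(g) u - rho'(g X g^-1) v)   for x = (g, v),
   and its own differential in x is the bracket of g+ = sl(4,R) |x V. *)
Definition gplus_Ad (R : realType) (n : nat) (rho : 'M[R]_4 -> 'M[R]_n)
    (x Y : 'M[R]_4 * 'cV[R]_n) : 'M[R]_4 * 'cV[R]_n :=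
  derive1 (fun t : R =>
    gplus_mul rho (gplus_mul rho x (expmx (t *: Y.1), t *: Y.2))
      (gplus_inv rho x)) 0.

(* The duality between (g+)^* = g^* (+) V^* and g+; V^* is the space of row
   vectors. *)
Definition gplus_pairing (R : realType) (n : nat) (l : 'M[R]_4 * 'rV[R]_n)
    (Y : 'M[R]_4 * 'cV[R]_n) : R :=
  \tr (l.1 *m Y.1) + (l.2 *m Y.2) 0 0.

(* Coad(x) l is the form Y |-> l (Ad (x^-1) Y) on g+. *)
Definition gplus_coad_orbit (R : realType) (n : nat)
    (rho : 'M[R]_4 -> 'M[R]_n) (l : 'M[R]_4 * 'rV[R]_n) :
    set ('M[R]_4 * 'rV[R]_n) :=
  [set l' | sl4 l'.1 /\ exists2 x, gplus x &
     forall Y, sl4 Y.1 ->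
       gplus_pairing l' Y =
       gplus_pairing l (gplus_Ad rho (gplus_inv rho x) Y)].

(* On sl4, phi is given by polynomials of total degree at most d in the 16
   matrix entries. *)
Definition polynomial_map_le (R : realType) (n d : nat)
    (phi : 'M[R]_4 -> 'rV[R]_n) : Prop :=
  exists p : 'I_n -> mpoly (4 * 4) R,
    (forall i m, m \in msupp (p i) -> (mdeg m <= d)%N) /\
    forall xi, sl4 xi ->
      forall i, phi xi 0 i = meval (mxvec xi 0) (p i).

(* Because of the relation \tr xi = 0, the degree of a polynomial map on sl4 is
   the least degree of the polynomials in the entries that represent it. *)
Definition polynomial_map_of_degree (R : realType) (n d : nat)
    (phi : 'M[R]_4 -> 'rV[R]_n) : Prop :=
  polynomial_map_le d phi /\
  forall e, (e < d)%N -> ~ polynomial_map_le e phi.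

Definition closed_convex_hull (R : realType) (E : normedModType R)
    (A : set E) : set E :=
  closure (smallest (@convex_set R E) A).

Definition overalgebra_map (R : realType) (n : nat)
    (phi : 'M[R]_4 -> 'rV[R]_n) (xi : 'M[R]_4) : 'M[R]_4 * 'rV[R]_n :=
  (xi, phi xi).

Definition almost_separating_overalgebra (R : realType) (d n : nat)
    (rho : 'M[R]_4 -> 'M[R]_n) (phi : 'M[R]_4 -> 'rV[R]_n) : Prop :=
  let Phi := overalgebra_map phi in
  [/\ is_representation rho,
      polynomial_map_of_degree d phi,
      forall xi, sl4 xi ->
        Phi @` coad_orbit xi = gplus_coad_orbit rho (Phi xi) &
      forall xi, generic xi ->
        finite_set [set O | exists2 xi', sl4 xi' &
          O = coad_orbit xi' /\
          closed_convex_hull (Phi @` coad_orbit xi') =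
          closed_convex_hull (Phi @` coad_orbit xi)]].

(* Main.v *)
Require Import Defs.
From mathcomp Require Import all_boot all_order all_algebra all_fingroup.
From mathcomp Require Import all_classical all_reals all_analysis.
From mathcomp Require Import complex.
From mathcomp Require mpoly.
Import -(notations) mpoly.
From mathcomp Require Import ring lra.

Set Implicit Arguments.
Unset Strict Implicit.
Unset Printing Implicit Defensive.
Import Order.TTheory GRing.Theory Num.Theory.
Import numFieldNormedType.Exports.

Local Open Scope classical_set_scope.
Local Open Scope ring_scope.

(** Write f = phi xi.  The inclusion of Coad(G+) Phi(xi) in Phi(Coad(G) xi),
    read on the elements (g, 0) of G+, says that phi is equivariant:
    phi (g xi g^-1) = f rho(g^-1).  Read on the elements (1, v), it says that
    phi (xi + eta) = f, where eta is the linear form X |-> f rho'(X) v.  By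
    equivariance this form is X |-> tr (M [xi, X]), where M is the gradient at
    xi of the polynomial function zeta |-> phi zeta v, so that eta = [M, xi]
    (phi_gradient_flow): phi is constant along the Hamiltonian vectors of its
    own components.

    Let xi be diagonal with distinct eigenvalues, and i <> j.  Conjugating
    gradients by the torus, which fixes f, isolates their entries
    (gradient_root).  Either some gradient has a nonzero entry (j, i), and then
    f is fixed by the root subgroup of E_ji; or all these entries vanish, and
    then f is fixed by the root subgroup of E_ij (root_dichotomy).  So f is
    fixed by a Borel subgroup of each SL2 attached to a pair of opposite roots;
    as in any algebraic representation of SL2, it is then fixed by all of SL2
    (root_symmetric).  The root subgroups generate SL4, hence phi is constant
    on the orbit of xi (phi_invariant_diag).

    Therefore Phi sends this orbit to its product with the point f.  The convex
    hull of the orbit is the whole of sl4 (midpoint_orbit_sl4), because the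
    orbit contains the lines xi + R E_ij.  Thus two regular diagonal orbits on
    which phi takes the same value are not separated by closed convex hulls.

    A cubic phi has infinitely many such orbits with the same value.  Take
    xi = diag(x, -x, y, -y) with x^2 + y^2 = 1: by invariance phi xi does not
    change under x |-> -x, y |-> -y and the exchange of x and y, and a
    polynomial of degree at most 3 in x and y with these symmetries is an affine
    function of x^2 + y^2 (average_polynomial).  But the determinant x^2 y^2,
    which is an invariant of the orbit, takes infinitely many values.

    The representation rho is only assumed continuous, and the coadjoint action
    involves the derivative of t |-> rho (exp (t X)); this derivative exists
    because continuous one-parameter groups of matrices are differentiable
    (one_parameter_derive). *)

(** * Curves of matrices *)

(** Entrywise, because the usual rules are available for scalar functions;
    [mx_derive_cvg] gives back the limit of the difference quotients in the
    space of matrices. *)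
Definition mx_derive (R : realType) (m n : nat) (M : R -> 'M[R]_(m, n))
    (t : R) (D : 'M[R]_(m, n)) : Prop :=
  forall i j, is_derive t 1 (fun s => M s i j) (D i j).

Lemma is_derive_sumT (R : realType) (I : finType) (f : I -> R -> R)
    (d : I -> R) (t : R) :
  (forall i, is_derive t 1 (f i) (d i)) ->
  is_derive t 1 (fun s => \sum_i f i s) (\sum_i d i).
Proof.
move=> fd; elim: (index_enum I) => [|i r IH].
  rewrite big_nil [X in is_derive _ _ X](_ : _ = cst 0); first exact: is_derive_cst.
  by apply/funext => s; rewrite big_nil.
rewrite big_cons [X in is_derive _ _ X](_ : _ = f i \+ (fun s => \sum_(j <- r) f j s)).
  exact: is_deriveD.
by apply/funext => s; rewrite big_cons.
Qed.

Lemma mx_derive_cst (R : realType) (m n : nat) (A : 'M[R]_(m, n)) (t : R) :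
  mx_derive (fun=> A) t 0.
Proof. by move=> i j; rewrite mxE; exact: is_derive_cst. Qed.

Lemma mx_deriveD (R : realType) (m n : nat) (M N : R -> 'M[R]_(m, n)) (t : R) A B :
  mx_derive M t A -> mx_derive N t B ->
  mx_derive (fun s => M s + N s) t (A + B).
Proof.
move=> MA NB i j; rewrite mxE.
rewrite [X in is_derive _ _ X](_ : _ = (fun s => M s i j) \+ (fun s => N s i j)).
  exact: is_deriveD.
by apply/funext => s; rewrite mxE.
Qed.

Lemma mx_deriveM (R : realType) (m n p : nat) (M : R -> 'M[R]_(m, n))
    (N : R -> 'M[R]_(n, p)) (t : R) A B :
  mx_derive M t A -> mx_derive N t B ->
  mx_derive (fun s => M s *m N s) t (A *m N t + M t *m B).
Proof.
move=> MA NB i j.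
rewrite [X in is_derive _ _ X](_ : _ = fun s => \sum_k M s i k * N s k j); last first.
  by apply/funext => s; rewrite mxE.
rewrite [X in is_derive _ _ _ X](_ : _ = \sum_k (A i k * N t k j + M t i k * B k j)).
  apply: is_derive_sumT => k; apply: is_derive_eq.
    by apply: is_deriveM; [exact: MA|exact: NB].
  by rewrite /GRing.scale/= addrC mulrC [X in X + _]mulrC; congr (_ + _); ring.
by rewrite !mxE big_split.
Qed.

Lemma mx_deriveN (R : realType) (m n : nat) (M : R -> 'M[R]_(m, n)) (t : R) A :
  mx_derive M t A -> mx_derive (fun s => - M s) t (- A).
Proof.
move=> MA i j; rewrite mxE.
rewrite [X in is_derive _ _ X](_ : _ = - (fun s => M s i j)).
  exact: is_deriveN.
by apply/funext => s; rewrite mxE.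
Qed.

Lemma is_derive_mull (R : realType) (f : R -> R) (k t d : R) :
  is_derive t 1 f d -> is_derive t 1 (fun s => k * f s) (k * d).
Proof. exact: (@is_deriveZ R R R f k t 1 d). Qed.

Lemma mx_derive_scale (R : realType) (m n : nat) (A : 'M[R]_(m, n)) (t : R) :
  mx_derive (fun s => s *: A) t A.
Proof.
move=> i j; rewrite [X in is_derive _ _ X](_ : _ = fun s => A i j * s).
  by have := is_derive_mull (A i j) (is_derive_id t (1 : R)); rewrite mulr1.
by apply/funext => s; rewrite mxE mulrC.
Qed.

Lemma mx_derive_shift (R : realType) (m n : nat)
    (M : R -> 'M[R]_(m, n)) (k t : R) A :
  mx_derive M (t + k) A -> mx_derive (fun s => M (s + k)) t A.
Proof.
move=> MA i j; have := MA i j => Mij.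
have h : is_derive t 1 (fun s : R => s + k) 1 := is_derive_shift t 1 k.
by have := is_derive1_comp (g := fun s => s + k) Mij h; rewrite mulr1.
Qed.

Lemma mx_derive_reflect (R : realType) (m n : nat)
    (M : R -> 'M[R]_(m, n)) (t : R) A :
  mx_derive M (- t) A -> mx_derive (fun s => M (- s)) t (- A).
Proof.
move=> MA i j; have := MA i j => Mij; rewrite mxE.
by have := is_derive1_comp (g := -%R) Mij (is_deriveNid t 1); rewrite mulrN1.
Qed.

Lemma is_derive0_itv_cst (R : realType) (f : R -> R) (a b : R) : a <= b ->
  (forall x, x \in `[a, b] -> is_derive x 1 f 0) -> f a = f b.
Proof.
move=> ab fd; apply/esym/eqP; rewrite -subr_eq0; apply/eqP.
have fo x : x \in `]a, b[ -> is_derive x 1 f 0.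
  by move=> xab; apply: fd; apply: subset_itv_oo_cc xab.
have fc : {within `[a, b], continuous f}.
  by apply: derivable_within_continuous => x xab; have [] := fd _ xab.
have [c _ fE] := MVT_segment ab fo fc.
by rewrite fE mul0r.
Qed.

Lemma local_primitive (R : realType) (f : R -> R) (a u : R) :
  continuous f ->
  exists F : R -> R, forall x, a < x < u -> is_derive x 1 F (f x).
Proof.
move=> cf; exists (fun x => \int[lebesgue_measure]_(t in [set` `[a, x]]) f t)%R.
move=> x /andP[ax xu].
have [|dF FE] := @continuous_FTC1_closed R f a x u xu _ ax (cf x).
  apply: continuous_compact_integrable; first exact: segment_compact.
  exact: continuous_subspaceT.
by rewrite -FE derive1E; exact: derivableP.
Qed.

Lemma cvg_bigsum (R : realType) (T I : Type) (F : set_system T) {FF : Filter F}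
    (r : seq I) (f : I -> T -> R) (l : I -> R) :
  (forall i, f i x @[x --> F] --> l i) ->
  (\sum_(i <- r) f i x) @[x --> F] --> \sum_(i <- r) l i.
Proof.
move=> fl; elim: r => [|i r IH].
  by rewrite big_nil; under eq_cvg do rewrite big_nil; exact: cvg_cst.
by rewrite big_cons; under eq_cvg do rewrite big_cons; apply: cvgD.
Qed.

Lemma cvg_bigprod (R : realType) (T I : Type) (F : set_system T) {FF : Filter F}
    (r : seq I) (f : I -> T -> R) (l : I -> R) :
  (forall i, f i x @[x --> F] --> l i) ->
  (\prod_(i <- r) f i x) @[x --> F] --> \prod_(i <- r) l i.
Proof.
move=> fl; elim: r => [|i r IH].
  by rewrite big_nil; under eq_cvg do rewrite big_nil; exact: cvg_cst.
by rewrite big_cons; under eq_cvg do rewrite big_cons; apply: cvgM.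
Qed.

Lemma cvg_det (R : realType) (n : nat) (T : Type) (F : set_system T) {FF : Filter F}
    (f : T -> 'M[R]_n) (l : 'M[R]_n) :
  (forall i j, f x i j @[x --> F] --> l i j) ->
  \det (f x) @[x --> F] --> \det l.
Proof.
move=> fl; apply: cvg_bigsum => s; apply: cvgM; first exact: cvg_cst.
by apply: cvg_bigprod => i; exact: fl.
Qed.

(** If F is a primitive of T, integrating T (s + t) = T s T t in s over [0, e]
    gives T t (F e - F 0) = F (t + e) - F t.  For small e the matrix F e - F 0 is
    invertible, since (F e - F 0) / e tends to 1; hence T is a differentiable
    function times a constant matrix. *)
Lemma one_parameter_derive (R : realType) (n : nat) (T : R -> 'M[R]_n) :
  (forall i j, continuous (fun t => T t i j)) -> T 0 = 1%:M ->
  (forall s t, T (s + t) = T s *m T t) ->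
  exists D, mx_derive T 0 D.
Proof.
move=> cT T0 TD.
have prim i j := local_primitive (-2) 2 (cT i j).
pose F t : 'M[R]_n := \matrix_(i, j) sval (cid (prim i j)) t.
have dF t : -2 < t < 2 -> mx_derive F t (T t).
  move=> ht i j; rewrite (_ : (fun s => _) = sval (cid (prim i j))).
    exact: (svalP (cid (prim i j))).
  by apply/funext => s; rewrite mxE.
have dT s t : -1 < t < 1 -> 0 <= s <= 1 ->
    T t *m (F s - F 0) = F (s + t) - F t.
  move=> /andP[t1 t2] /andP[s0 s1]; apply/matrixP => i j.
  pose G s : 'M[R]_n := T t *m (F s + - F 0) + - (F (s + t) + - F t).
  suff : G 0 i j = G s i j.
    rewrite /G add0r !subrr mulmx0 subr0 [LHS]mxE => /esym/eqP.
    by rewrite mxE [X in _ + X]mxE subr_eq0 => /eqP.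
  apply: (@is_derive0_itv_cst _ (fun s => G s i j)) => // x.
  rewrite in_itv/= => /andP[x0 x1].
  have : mx_derive G x (0 *m (F x + - F 0) + T t *m (T x + 0) + - (T (x + t) + 0)).
    have FxN := dF x; have Fxt := dF (x + t).
    apply: mx_deriveD; last apply: mx_deriveN.
      apply: mx_deriveM; first exact: mx_derive_cst.
      by apply: mx_deriveD; [apply: FxN; lra|exact: mx_derive_cst].
    apply: mx_deriveD; last exact: mx_derive_cst.
    by apply: mx_derive_shift; apply: Fxt; lra.
  by rewrite mul0mx add0r !addr0 [x + t]addrC TD subrr => /(_ i j); rewrite mxE.
have [e /andP[e0 e1] eU] : exists2 e, 0 < e < 1 & F e - F 0 \in unitmx.
  pose Q e : 'M[R]_n := e^-1 *: (F e - F 0).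
  have : \det (Q e) @[e --> 0^'] --> \det (T 0).
    apply: cvg_det => i j.
    have /(_ _ i j)[]// := dF 0; first lra.
    move=> /cvg_ex[/= l hl].
    rewrite /derive (cvg_lim _ hl)// => <-.
    rewrite (_ : (fun x : R => Q x i j) =
      (fun h => h^-1 *: (F (h *: 1 + 0) i j - F 0 i j)))//.
    by apply/funext => h; rewrite !mxE addr0 /GRing.scale/= mulr1.
  rewrite T0 det1 => /cvgrPdist_lt /(_ 1 ltr01) h.
  have [d /= d0 hd] := h.
  pose e := Num.min (d / 2) (1 / 2).
  have e0 : 0 < e by rewrite lt_min; apply/andP; split; lra.
  have ed : e <= d / 2 by rewrite ge_min lexx.
  have e1 : e <= 1 / 2 by rewrite ge_min lexx orbT.
  exists e; first lra.
  have hq : `|1 - \det (Q e)| < 1.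
    apply: hd; last exact: lt0r_neq0.
    by rewrite /= sub0r normrN gtr0_norm//; lra.
  have : Q e \in unitmx.
    rewrite unitmxE unitfE; apply/eqP => Q0; move: hq.
    by rewrite Q0 subr0 normr1 ltxx.
  by rewrite unitmxZ// unitfE invr_eq0 lt0r_neq0.
exists ((T e + - T 0) *m invmx (F e - F 0)).
have dG : mx_derive (fun t => (F (t + e) + - F t) *m invmx (F e - F 0)) 0
    ((T e + - T 0) *m invmx (F e - F 0)).
  have -> : (T e + - T 0) *m invmx (F e - F 0) =
     (T e + - T 0) *m invmx (F e - F 0) + (F (0 + e) + - F 0) *m 0.
    by rewrite mulmx0 addr0.
  apply: (@mx_deriveM _ _ _ _ (fun t => F (t + e) + - F t)
    (fun=> invmx (F e - F 0))); last exact: mx_derive_cst.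
  apply: mx_deriveD.
    by apply: mx_derive_shift; rewrite -{2}[e]add0r; apply: dF; lra.
  have dF0 := dF 0.
  by apply: mx_deriveN; apply: dF0; lra.
move=> i j; apply: near_eq_is_derive (dG i j).
near=> t.
rewrite [t + e]addrC -dT; last 2 first.
- by apply/andP; split; near: t; [apply: lt_nbhsr|apply: lt_nbhsl]; lra.
- by rewrite !ltW.
by rewrite mulmxK.
Unshelve. all: by end_near. Qed.

(** * The matrix exponential *)

Lemma is_derive_bigprod (R : realType) (I : eqType) (r : seq I) (f : I -> R -> R)
    (d : I -> R) (t : R) : uniq r ->
  (forall i, is_derive t 1 (f i) (d i)) ->
  is_derive t 1 (fun s => \prod_(i <- r) f i s)
    (\sum_(i <- r) d i * \prod_(j <- r | j != i) f j t).
Proof.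
move=> + fd; elim: r => [|i r IH] /=.
  rewrite big_nil [X in is_derive _ _ X](_ : _ = cst 1).
    by move=> _; exact: is_derive_cst.
  by apply/funext => s; rewrite big_nil.
move=> /andP[ir ur].
rewrite [X in is_derive _ _ X](_ : _ = f i \* (fun s => \prod_(j <- r) f j s)); last first.
  by apply/funext => s; rewrite big_cons.
apply: is_derive_eq; first by apply: is_deriveM; exact: IH.
rewrite !big_cons eqxx/= addrC; congr (_ + _).
  rewrite /GRing.scale/= mulrC; congr (_ * _).
  rewrite big_seq_cond [RHS]big_seq_cond; apply: eq_bigl => j.
  by case: (boolP (j \in r)) => //= jr; rewrite (memPn ir).
rewrite /GRing.scale/= mulr_sumr.
apply: eq_big_seq => j jr; rewrite big_cons eq_sym (memPn ir)//.
by rewrite mulrCA.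
Qed.

(** In the Leibniz formula, a permutation other than the identity moves at least
    two indices, so its product has a double zero where M is the identity. *)
Lemma is_derive_det1 (R : realType) (n : nat) (M : R -> 'M[R]_n) (t : R)
    (D : 'M[R]_n) :
  mx_derive M t D -> M t = 1%:M ->
  is_derive t 1 (fun s => \det (M s)) (\tr D).
Proof.
move=> MD M1; rewrite /determinant.
rewrite [X in is_derive _ _ _ X](_ : _ = \sum_(s : 'S_n)
    ((-1) ^+ s * \sum_(i <- index_enum 'I_n) (D i (s i)) *
      \prod_(j <- index_enum 'I_n | j != i) M t j (s j))).
  apply: is_derive_sumT => s; apply: is_derive_mull.
  apply: (is_derive_bigprod (f := fun i x => M x i (s i))
    (d := fun i => D i (s i))) => //.
  exact: index_enum_uniq.
rewrite M1 (bigD1 1%g)//= [X in _ + X]big1 ?addr0 => [|s s1].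
  rewrite odd_perm1 expr0 mul1r /mxtrace; apply: eq_bigr => i _.
  rewrite perm1 big1 ?mulr1// => j _.
  by rewrite perm1 mxE eqxx.
rewrite big1 ?mulr0// => i _.
have [j /andP[ji sj]] : exists j, (j != i) && (s j != j).
  apply/existsP; apply: contraR s1; rewrite negb_exists => /forallP h.
  have fixj j : j != i -> s j = j.
    by move=> ji; have := h j; rewrite ji/= negbK => /eqP.
  apply/eqP/permP => j; rewrite perm1.
  have [->|/fixj//] := eqVneq j i.
  have [//|/fixj/perm_inj//] := eqVneq (s i) i.
rewrite (bigD1 j)//=.
by rewrite mxE eq_sym (negbTE sj) mul0r mulr0.
Qed.

Lemma cvg_mx (R : realType) (m n : nat) (T : Type) (F : set_system T) {FF : Filter F}
    (f : T -> 'M[R]_(m, n)) (l : 'M[R]_(m, n)) :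
  (forall i j, f x i j @[x --> F] --> l i j) -> f x @[x --> F] --> l.
Proof.
move=> fl A [P PA sPA]; rewrite nbhs_simpl.
have : \forall x \near F, forall ij : 'I_m * 'I_n, P ij.1 ij.2 (f x ij.1 ij.2).
  by apply: filter_forall => -[i j] /=; apply: fl; exact: PA.
apply: filterS => x hx; apply: sPA => i j; exact: (hx (i, j)).
Qed.

Section exponential.
Variable R : realType.
Implicit Types X : 'M[R]_4.

(** The entries of exp (t X) are power series in t; the index p counts
    differentiations, each of which multiplies by X. *)
Definition expmx_coef X (p : nat) (i j : 'I_4) (k : nat) : R :=
  (X ^+ (p + k)) i j / k`!%:R.

Lemma expmx_coef_diffs X p i j :
  pseries_diffs (expmx_coef X p i j) = expmx_coef X p.+1 i j.
Proof.
apply/funext => k; rewrite /pseries_diffs /expmx_coef factS natrM invfM addSnnS.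
by rewrite mulrCA (mulrA k.+1%:R) divff ?mul1r// pnatr_eq0.
Qed.

Lemma exprmx_bound X : exists2 B : R, 0 <= B & forall k i j, `|(X ^+ k) i j| <= B ^+ k.
Proof.
pose C := \sum_i \sum_j `|X i j|.
have CX i j : `|X i j| <= C.
  rewrite /C (bigD1 i)//= (bigD1 j)//= -addrA lerDl addr_ge0// sumr_ge0// => l _.
  by rewrite sumr_ge0.
have C0 : 0 <= C by rewrite sumr_ge0// => i _; rewrite sumr_ge0.
exists (C *+ 4); first by rewrite mulrn_wge0.
elim=> [|k IH] i j.
  by rewrite !expr0 mxE; case: eqP => _; rewrite ?normr1 ?normr0.
rewrite exprS mxE (le_trans (ler_norm_sum _ _ _))//.
rewrite exprS mulrnAl; set P := (X in _ <= X *+ 4).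
have -> : P *+ 4 = \sum_(l < 4) P by rewrite sumr_const card_ord.
by apply: ler_sum => l _; rewrite normrM; apply: ler_pM.
Qed.

Lemma cvg_pseries_expmx X p i j (t : R) : cvgn (pseries (expmx_coef X p i j) t).
Proof.
have [B B0 XB] := exprmx_bound X.
apply: normed_cvg.
apply: (@series_le_cvg _ _ (fun k => B ^+ p * exp_coeff (B * `|t|) k)).
- by move=> k; exact: normr_ge0.
- by move=> k; rewrite mulr_ge0 ?exprn_ge0// exp_coeff_ge0// mulr_ge0.
- move=> k; rewrite /expmx_coef /exp_coeff/= !normrM normrX normfV normr_nat.
  rewrite exprMn mulrA mulrA -exprD mulrAC ler_wpM2r ?invr_ge0//.
  by rewrite ler_wpM2r ?exprn_ge0.
- rewrite (_ : (fun k => _) = B ^+ p *: exp_coeff (B * `|t|)) //.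
  exact/is_cvg_seriesZ/is_cvg_series_exp_coeff.
Qed.

Lemma expmxE X t i j : expmx (t *: X) i j = limn (pseries (expmx_coef X 0 i j) t).
Proof.
pose L : 'M[R]_4 := \matrix_(i, j) limn (pseries (expmx_coef X 0 i j) t).
suff -> : expmx (t *: X) = L by rewrite mxE.
apply/cvg_lim => //; apply: cvg_mx => k l; rewrite mxE.
rewrite (_ : (fun x => _) = pseries (expmx_coef X 0 k l) t); first exact: cvg_pseries_expmx.
apply/funext => n; rewrite /series/= summxE; apply: eq_bigr => m _.
by rewrite exprZn !mxE /= /expmx_coef add0n; ring.
Qed.

Lemma expmx_derive_lim X t : mx_derive (fun t => expmx (t *: X)) t
  (\matrix_(i, j) limn (pseries (expmx_coef X 1 i j) t)).
Proof.
move=> i j; rewrite mxE -expmx_coef_diffs.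
rewrite (_ : (fun s => _) = fun s => limn (pseries (expmx_coef X 0 i j) s)).
  apply: (@pseries_snd_diffs _ _ (`|t| + 1));
    rewrite ?expmx_coef_diffs ?ltr_normr ?ltrDl ?ltr01//;
    exact: cvg_pseries_expmx.
by apply/funext => s; rewrite expmxE.
Qed.

Lemma expmx_derivel X t : mx_derive (fun t => expmx (t *: X)) t (X *m expmx (t *: X)).
Proof.
rewrite (_ : X *m _ = \matrix_(i, j) limn (pseries (expmx_coef X 1 i j) t)).
  exact: expmx_derive_lim.
apply/matrixP => i j; rewrite !mxE; apply/esym/cvg_lim => //.
under eq_bigr do rewrite expmxE.
rewrite (_ : pseries _ _ = fun n => \sum_k X i k * pseries (expmx_coef X 0 k j) t n).
  by apply: cvg_bigsum => k; apply: cvgM; [exact: cvg_cst|exact: cvg_pseries_expmx].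
apply/funext => n; rewrite /pseries /series/=.
under [RHS]eq_bigr do rewrite mulr_sumr.
rewrite exchange_big; apply: eq_bigr => k _ /=.
rewrite /expmx_coef add1n exprS mxE !mulr_suml; apply: eq_bigr => l _.
by rewrite add0n !mulrA.
Qed.

Lemma expmx_deriver X t : mx_derive (fun t => expmx (t *: X)) t (expmx (t *: X) *m X).
Proof.
rewrite (_ : _ *m X = \matrix_(i, j) limn (pseries (expmx_coef X 1 i j) t)).
  exact: expmx_derive_lim.
apply/matrixP => i j; rewrite !mxE; apply/esym/cvg_lim => //.
under eq_bigr do rewrite expmxE.
rewrite (_ : pseries _ _ = fun n => \sum_k pseries (expmx_coef X 0 i k) t n * X k j).
  by apply: cvg_bigsum => k; apply: cvgM; [exact: cvg_pseries_expmx|exact: cvg_cst].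
apply/funext => n; rewrite /pseries /series/=.
under [RHS]eq_bigr do rewrite mulr_suml.
rewrite exchange_big; apply: eq_bigr => k _ /=.
rewrite /expmx_coef add1n exprSr mxE !mulr_suml; apply: eq_bigr => l _.
by rewrite add0n; ring.
Qed.

Lemma expmx0 : expmx 0 = 1%:M :> 'M[R]_4.
Proof.
apply/matrixP => i j; rewrite -(scale0r 0) expmxE.
apply/cvg_lim => //; apply: cvg_near_cst; near=> n.
rewrite /pseries /series/= big_mkord.
have n0 : (0 < n)%N by near: n; exists 1%N.
rewrite -(prednK n0) big_ord_recl big1 => [|k _].
  by rewrite addr0 /expmx_coef !expr0 fact0 divr1 mulr1.
by rewrite lift0 expr0n/= mulr0.
Unshelve. all: by end_near. Qed.

Lemma mx_derive0_cst m n (M : R -> 'M[R]_(m, n)) s t :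
  (forall x, mx_derive M x 0) -> M s = M t.
Proof.
move=> M0; apply/matrixP => i j.
by apply: (@is_derive_0_is_cst _ (fun x => M x i j)) => x; have := M0 x i j; rewrite mxE.
Qed.

(** The curve u |-> exp (-u X) exp ((u + v) X) has zero derivative. *)
Lemma expmxD X s t : expmx ((s + t) *: X) = expmx (s *: X) *m expmx (t *: X).
Proof.
pose E t := expmx (t *: X).
have H0 u v : E (- u) *m E (u + v) = E v.
  transitivity (E (- 0) *m E (0 + v)); last first.
    by rewrite oppr0 add0r {1}/E scale0r expmx0 mul1mx.
  apply: (@mx_derive0_cst _ _ (fun u => E (- u) *m E (u + v))) => x.
  rewrite [X in mx_derive _ _ X](_ : _ =
    - (E (- x) *m X) *m E (x + v) + E (- x) *m (X *m E (x + v))).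
    apply: mx_deriveM; last exact/mx_derive_shift/expmx_derivel.
    exact/mx_derive_reflect/expmx_deriver.
  by rewrite mulNmx mulmxA addNr.
have E1 u : E (- u) *m E u = 1%:M.
  by have := H0 u 0; rewrite addr0 => ->; rewrite /E scale0r expmx0.
rewrite -/(E _) -/(E s) -/(E t) -(H0 s t) mulmxA.
by have := E1 (- s); rewrite opprK => ->; rewrite mul1mx.
Qed.

(** By the group law, t |-> det (exp (t X)) is a morphism to the multiplicative
    group whose derivative at 0 is the trace of X. *)
Lemma det_expmx X t : \tr X = 0 -> \det (expmx (t *: X)) = 1.
Proof.
move=> trX; pose d t := \det (expmx (t *: X)).
have -> : 1 = d 0 by rewrite /d scale0r expmx0 det1.
apply: is_derive_0_is_cst => x.
rewrite (_ : d = fun s => d x * (d \o shift (- x)) s); last first.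
  apply/funext => s; rewrite /d -{1}(subrK x s) addrC expmxD det_mulmx.
  by rewrite /= /shift.
have d0 : is_derive (x - x) 1 d 0.
  rewrite subrr -[X in is_derive _ _ _ X]trX.
  apply: (is_derive_det1 (M := fun t => expmx (t *: X))).
    by have := expmx_derivel X 0; rewrite scale0r expmx0 mulmx1.
  by rewrite scale0r expmx0.
have := is_derive1_comp (g := shift (- x)) d0 (is_derive_shift x 1 (- x)).
rewrite mulr1 => dd.
by have := is_derive_mull (d x) dd; rewrite mulr0.
Qed.

End exponential.

(** * Coadjoint orbits of the semidirect product *)

Lemma mx_derive_cvg (R : realType) (m n : nat) (A : R -> 'M[R]_(m, n))
    (dA : 'M[R]_(m, n)) (t : R) :
  mx_derive A t dA -> h^-1 *: (A (h + t) - A t) @[h --> 0^'] --> dA.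
Proof.
move=> dAt; apply: cvg_mx => i j; have [/cvg_ex[/= l hl] <-] := dAt i j.
rewrite /derive (cvg_lim _ hl)//.
rewrite (_ : (fun h => _) = (fun h => h^-1 *: (A (h *: 1 + t) i j - A t i j)))//.
by apply/funext => h; rewrite !mxE /GRing.scale/= mulr1.
Qed.

Lemma derive1_pair (R : realType) (m n p q : nat) (A : R -> 'M[R]_(m, n))
    (B : R -> 'M[R]_(p, q)) (dA : 'M[R]_(m, n)) (dB : 'M[R]_(p, q)) (t : R) :
  mx_derive A t dA -> mx_derive B t dB ->
  derive1 (fun s => (A s, B s)) t = (dA, dB).
Proof.
move=> /mx_derive_cvg hA /mx_derive_cvg hB; apply: cvg_lim => //.
exact: (cvg_pair hA hB).
Qed.

Lemma mx_derive_continuous (R : realType) (m n : nat) (A dA : R -> 'M[R]_(m, n)) :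
  (forall t, mx_derive A t (dA t)) -> continuous A.
Proof.
move=> AD t; apply: cvg_mx => i j.
apply: (differentiable_continuous (f := fun s => A s i j)).
by apply/derivable1_diffP; have [] := AD t i j.
Qed.

Lemma SL4_unit (R : realType) (g : 'M[R]_4) : SL4 g -> g \in unitmx.
Proof. by move=> g1; rewrite unitmxE g1 unitr1. Qed.

Lemma SL4M (R : realType) (g h : 'M[R]_4) : SL4 g -> SL4 h -> SL4 (g *m h).
Proof. by move=> g1 h1; rewrite /SL4/= det_mulmx g1 h1 mulr1. Qed.

Lemma SL4V (R : realType) (g : 'M[R]_4) : SL4 g -> SL4 (invmx g).
Proof. by move=> g1; rewrite /SL4/= det_inv g1 invr1. Qed.

Lemma SL4_1 (R : realType) : SL4 (1%:M : 'M[R]_4).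
Proof. by rewrite /SL4/= det1. Qed.

Lemma SL4_expmx (R : realType) (X : 'M[R]_4) (t : R) : sl4 X -> SL4 (expmx (t *: X)).
Proof. by move=> X0; exact: det_expmx. Qed.

Lemma invmx_expmx (R : realType) (X : 'M[R]_4) (t : R) :
  invmx (expmx (t *: X)) = expmx (- t *: X).
Proof.
have tN : expmx (t *: X) *m expmx (- t *: X) = 1%:M.
  by rewrite -expmxD subrr scale0r expmx0.
have [u _] := mulmx1_unit tN.
by rewrite -[RHS]mul1mx -(mulVmx u) -mulmxA tN mulmx1.
Qed.

Lemma sl4_conj (R : realType) (g xi : 'M[R]_4) : SL4 g -> sl4 xi ->
  sl4 (g *m xi *m invmx g).
Proof.
move=> g1 xi0; rewrite /sl4/= mxtrace_mulC mulmxA mulVmx ?mul1mx//.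
exact: SL4_unit.
Qed.

Lemma sl4_delta (R : realType) (i j : 'I_4) (k : R) : i != j ->
  sl4 (k *: delta_mx i j).
Proof.
move=> ij; rewrite /sl4/= mxtraceZ (_ : \tr _ = 0) ?mulr0//.
rewrite /mxtrace big1// => p _; rewrite mxE.
by case: eqP => [->|]//; rewrite (negbTE ij).
Qed.

Section representation.
Variables (R : realType) (n : nat) (rho : 'M[R]_4 -> 'M[R]_n).
Hypothesis rhoP : is_representation rho.

Let rho1 : rho 1%:M = 1%:M. Proof. by case: rhoP. Qed.
Let rhoM g h : SL4 g -> SL4 h -> rho (g *m h) = rho g *m rho h.
Proof. by case: rhoP => _ + _; exact. Qed.

(** This is what makes the coadjoint action of G+ computable: a non-differentiable
    curve would have a meaningless [derive1]. *)
Lemma representation_derive X : sl4 X ->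
  exists D, mx_derive (fun t => rho (expmx (t *: X))) 0 D.
Proof.
move=> X0; apply: one_parameter_derive.
- move=> i j t.
  have ct : expmx (s *: X) @[s --> t] --> expmx (t *: X).
    apply: (mx_derive_continuous (A := fun s => expmx (s *: X))) => s.
    exact: expmx_derivel.
  case: rhoP => _ _ /subspace_continuousP /(_ _ (SL4_expmx t X0)) rc.
  have rct : rho (expmx (s *: X)) @[s --> t] --> rho (expmx (t *: X)).
    apply: cvg_comp rc => A; rewrite /within/= => hA.
    have := ct _ hA; rewrite !nbhs_simpl/=; apply: filterS => s; apply.
    exact: SL4_expmx.
  apply: (@cvg_comp _ _ _ (fun s => rho (expmx (s *: X)))
    (fun A : 'M[R]_n => A i j) _ _ _ rct).
  exact: (differentiable_continuous (differentiable_coord _ i j)).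
- by rewrite scale0r expmx0.
- by move=> s t; rewrite expmxD rhoM//; exact: SL4_expmx.
Qed.

Lemma gplus_Ad_translation (v : 'cV[R]_n) Y D :
  mx_derive (fun t => rho (expmx (t *: Y.1))) 0 D ->
  gplus_Ad rho (gplus_inv rho (1%:M, v)) Y = (Y.1, Y.2 + D *m v).
Proof.
move=> dD; rewrite /gplus_Ad /gplus_mul/= !invmx1 rho1 !mul1mx opprK.
under eq_fun do rewrite mulmx1 !mul1mx.
apply: derive1_pair.
  by have := expmx_derivel Y.1 0; rewrite scale0r expmx0 mulmx1.
apply: mx_deriveD.
  rewrite -[X in mx_derive _ _ X]add0r.
  by apply: mx_deriveD; [exact: mx_derive_cst|exact: mx_derive_scale].
have := mx_deriveM dD (mx_derive_cst v 0).
by rewrite mulmx0 addr0.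
Qed.

Lemma gplus_Ad_SL4 (g : 'M[R]_4) Y : SL4 g ->
  gplus_Ad rho (gplus_inv rho (g, 0)) Y =
  (invmx g *m Y.1 *m g, rho (invmx g) *m Y.2).
Proof.
move=> g1; rewrite /gplus_Ad /gplus_mul/= !invmxK !mulmx0 oppr0 mulmx0 oppr0.
under eq_fun do rewrite mulmx0 addr0 add0r.
apply: derive1_pair.
  have := mx_deriveM (mx_deriveM (mx_derive_cst (invmx g) 0)
    (expmx_derivel Y.1 0)) (mx_derive_cst g 0).
  by rewrite scale0r expmx0 !mulmx1 add0r mulmx0 addr0.
have := mx_deriveM (mx_derive_cst (rho (invmx g)) 0) (mx_derive_scale Y.2 0).
by rewrite mul0mx add0r.
Qed.

Variable phi : 'M[R]_4 -> 'rV[R]_n.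
Hypothesis phiP : forall xi, sl4 xi ->
  overalgebra_map phi @` coad_orbit xi =
  gplus_coad_orbit rho (overalgebra_map phi xi).

(** The element (g, 0) of G+. *)
Lemma phi_equivariant g xi : SL4 g -> sl4 xi ->
  phi (g *m xi *m invmx g) = phi xi *m rho (invmx g).
Proof.
move=> g1 xi0.
have : gplus_coad_orbit rho (overalgebra_map phi xi)
    (g *m xi *m invmx g, phi xi *m rho (invmx g)).
  split; first exact: sl4_conj.
  exists (g, 0) => // Y Y0; rewrite gplus_Ad_SL4// /gplus_pairing/=.
  rewrite mulmxA; congr (_ + _).
  by rewrite -!mulmxA mxtrace_mulC !mulmxA.
by rewrite -phiP// => -[_ _ [-> ->]].
Qed.

(** The element (1, v) of G+ fixes the component in the dual of V and translates
    the component in the dual of g by the form X |-> phi xi rho'(X) v. *)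
Lemma phi_translation (v : 'cV[R]_n) xi eta : sl4 xi -> sl4 eta ->
  (forall X D, sl4 X -> mx_derive (fun t => rho (expmx (t *: X))) 0 D ->
    \tr (eta *m X) = (phi xi *m D *m v) 0 0) ->
  phi (xi + eta) = phi xi.
Proof.
move=> xi0 eta0 etaP.
have : gplus_coad_orbit rho (overalgebra_map phi xi) (xi + eta, phi xi).
  split; first by rewrite /sl4/= mxtraceD xi0 eta0 addr0.
  exists (1%:M, v) => [|Y Y0]; first exact: SL4_1.
  have [D dD] := representation_derive Y0.
  rewrite (gplus_Ad_translation v dD) /gplus_pairing/=.
  rewrite mulmxDl mxtraceD (etaP _ _ Y0 dD) mulmxDr [in RHS]mxE mulmxA.
  by rewrite -addrA; congr (_ + _); exact: addrC.
by rewrite -phiP// => -[_ _ [-> ->]].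
Qed.

End representation.

(** * Polynomial maps along curves *)

(** The chain rule along arbitrary curves through x0, with derivatives at x0 that
    do not depend on the curve. *)
Definition has_gradient (R : realType) (N : nat) (G : ('I_N -> R) -> R)
    (x0 : 'I_N -> R) : Prop :=
  exists c : 'I_N -> R, forall (x : R -> 'I_N -> R) (t : R) (d : 'I_N -> R),
    x t = x0 -> (forall i, is_derive t 1 (fun s => x s i) (d i)) ->
    is_derive t 1 (fun s => G (x s)) (\sum_i c i * d i).

Section gradient.
Variables (R : realType) (N : nat) (x0 : 'I_N -> R).

Lemma has_gradient_cst (k : R) : has_gradient (fun=> k) x0.
Proof.
exists (fun=> 0) => x t d _ _; rewrite big1 => [|i _]; last by rewrite mul0r.
exact: is_derive_cst.
Qed.

Lemma has_gradient_var (i : 'I_N) : has_gradient (fun x => x i) x0.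
Proof.
exists (fun j => (j == i)%:R) => x t d _ dx; rewrite (bigD1 i)//= eqxx mul1r.
by rewrite big1 ?addr0// => j /negbTE ->; rewrite mul0r.
Qed.

Lemma has_gradientD G H : has_gradient G x0 -> has_gradient H x0 ->
  has_gradient (fun x => G x + H x) x0.
Proof.
move=> [c cG] [c' cH]; exists (fun i => c i + c' i) => x t d xt dx.
under eq_bigr do rewrite mulrDl.
rewrite big_split; apply: is_deriveD; [exact: cG|exact: cH].
Qed.

Lemma has_gradientM G H : has_gradient G x0 -> has_gradient H x0 ->
  has_gradient (fun x => G x * H x) x0.
Proof.
move=> [c cG] [c' cH].
exists (fun i => G x0 * c' i + H x0 * c i) => x t d xt dx.
apply: is_derive_eq.
  by apply: is_deriveM; [exact: cG xt dx|exact: cH xt dx].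
rewrite /= xt /GRing.scale/= !mulr_sumr -big_split/=.
by apply: eq_bigr => i _; rewrite mulrDl !mulrA.
Qed.

Lemma has_gradient_meval (p : mpoly N R) : has_gradient (fun x => meval x p) x0.
Proof.
elim/mpolyind: p => [|k m p _ _ IH].
  rewrite (_ : (fun _ => _) = fun=> 0); first exact: has_gradient_cst.
  by apply/funext => x; rewrite meval0.
rewrite (_ : (fun _ => _) = fun x => k * (\prod_i x i ^+ m i) + meval x p); last first.
  by apply/funext => x; rewrite mevalD mevalZ mevalX.
apply: has_gradientD => //; apply: has_gradientM; first exact: has_gradient_cst.
elim: (index_enum _) => [|i r IHr].
  rewrite (_ : (fun _ => _) = fun=> 1); first exact: has_gradient_cst.
  by apply/funext => x; rewrite big_nil.
rewrite (_ : (fun _ => _) = fun x => x i ^+ m i * \prod_(j <- r) x j ^+ m j); last first.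
  by apply/funext => x; rewrite big_cons.
apply: has_gradientM => //; elim: (m i) => [|e IHe].
  rewrite (_ : (fun _ => _) = fun=> 1); first exact: has_gradient_cst.
  by apply/funext => x; rewrite expr0.
rewrite (_ : (fun _ => _) = fun x => x i * x i ^+ e); last first.
  by apply/funext => x; rewrite exprS.
by apply: has_gradientM => //; exact: has_gradient_var.
Qed.

End gradient.

Lemma meval_poly (R : realType) (N : nat) (p : mpoly N R) (x : 'I_N -> {poly R}) :
  exists P : {poly R}, forall c, meval (fun i => (x i).[c]) p = P.[c].
Proof.
exists (\sum_(m <- msupp p) mcoeff m p *: \prod_i x i ^+ m i) => c.
rewrite mevalE horner_sum; apply: eq_bigr => m _.
rewrite hornerZ horner_prod; congr (_ * _); apply: eq_bigr => i _.
by rewrite horner_exp.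
Qed.

(** Linearity in the velocity D is the point: it makes X |-> phi xi rho'(X) v
    linear without any Lie theory for rho. *)
Lemma polynomial_map_derive (R : realType) (n d : nat)
    (phi : 'M[R]_4 -> 'rV[R]_n) (xi : 'M[R]_4) :
  polynomial_map_le d phi ->
  exists L : 'I_n -> 'M[R]_4,
    forall (gamma : R -> 'M[R]_4) (t : R) (D : 'M[R]_4),
    gamma t = xi -> (forall s, sl4 (gamma s)) -> mx_derive gamma t D ->
    forall i, is_derive t 1 (fun s => phi (gamma s) 0 i) (\tr (L i *m D)).
Proof.
move=> [p [_ phiE]].
have /choice[c cP] i := has_gradient_meval (mxvec xi 0) (p i).
exists (fun i => (vec_mx (\row_j c i j))^T) => gamma t D gt g0 gD i.
rewrite (_ : (fun _ => _) = (fun s => meval (mxvec (gamma s) 0) (p i))); last first.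
  by apply/funext => s; exact: phiE.
rewrite (_ : \tr _ = \sum_k c i k * mxvec D 0 k).
  apply: (cP i (fun s => mxvec (gamma s) 0)); first by rewrite gt.
  move=> k; case/mxvec_indexP: k => k l; rewrite mxvecE.
  rewrite (_ : (fun _ => _) = fun s => gamma s k l); first exact: gD.
  by apply/funext => s; rewrite mxvecE.
rewrite /mxtrace; under eq_bigr do rewrite mxE.
rewrite exchange_big/= pair_bigA/= [RHS](reindex _ (curry_mxvec_bij _ _))/=.
by apply: eq_bigr => -[k l] _ /=; rewrite mxvecE !mxE.
Qed.

Lemma polynomial_map_poly (R : realType) (n d : nat) (phi : 'M[R]_4 -> 'rV[R]_n)
    (A B C : 'M[R]_4) :
  polynomial_map_le d phi -> sl4 A -> sl4 B -> sl4 C ->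
  forall i, exists P : {poly R},
    forall c, phi (A + c *: B + c ^+ 2 *: C) 0 i = P.[c].
Proof.
move=> [p [_ phiE]] A0 B0 C0 i.
have [P hP] := meval_poly (p i) (fun k =>
  (mxvec A 0 k)%:P + mxvec B 0 k *: 'X + mxvec C 0 k *: 'X^2).
exists P => c; rewrite -hP phiE.
  apply: meval_eq => k; case/mxvec_indexP: k => i' j'; rewrite !hornerE !mxvecE !mxE.
  by rewrite mulrC expr2 [c * c * _]mulrC mulrA.
by rewrite /sl4/= !mxtraceD !mxtraceZ A0 B0 C0 !mulr0 !addr0.
Qed.

Lemma poly_eq0_off0 (R : realType) (S : {poly R}) :
  (forall c, c != 0 -> S.[c] = 0) -> S = 0.
Proof.
move=> S0; apply: (@roots_geq_poly_eq0 _ _ [seq k.+1%:R | k <- iota 0 (size S)]).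
- by apply/allP => _ /mapP[k _ ->]; apply/rootP/S0; rewrite pnatr_eq0.
- rewrite map_inj_uniq ?iota_uniq// => k l /eqP.
  by rewrite eqr_nat eqSS => /eqP.
- by rewrite size_map size_iota.
Qed.

(** If m bounds the degree of Q, then P 'X^m is the reversal of Q, whose degree is
    at most m. *)
Lemma poly_inv_const (R : realType) (P Q : {poly R}) :
  (forall c, c != 0 -> P.[c] = Q.[c^-1]) -> forall c, P.[c] = P.[0].
Proof.
move=> PQ.
pose m := size Q.
pose Qr := \poly_(k < m.+1) Q`_(m - k).
have XP : P * 'X^m = Qr.
  apply/eqP; rewrite -subr_eq0; apply/eqP/poly_eq0_off0 => c c0.
  rewrite hornerD hornerN hornerM hornerXn PQ// horner_poly.
  rewrite (@horner_coef_wide _ m.+1) ?leqnSn// mulr_suml.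
  apply/eqP; rewrite subr_eq0; apply/eqP.
  rewrite [RHS](reindex_inj rev_ord_inj)/=; apply: eq_bigr => k _.
  rewrite subSS subKn; last by rewrite -ltnS.
  have km : (k <= m)%N by rewrite -ltnS.
  have -> : c ^+ m = c ^+ (m - k) * c ^+ k by rewrite -exprD subnK.
by rewrite exprVn -mulrA [_^-1 * _]mulrC mulfK ?expf_neq0.
have sP : (size P <= 1)%N.
  have [->|P0] := eqVneq P 0; first by rewrite size_poly0.
  have := size_poly m.+1 (fun k => Q`_(m - k)); rewrite -/Qr -XP size_mulXn//.
  by rewrite -[m.+1]addn1 leq_add2l.
by move=> c; rewrite (size1_polyC sP) !hornerC.
Qed.

(** * Transvections *)

Section transvection.
Variables (F : fieldType) (n : nat).
Implicit Types (i j : 'I_n) (k c : F).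

Definition transvection i j k : 'M[F]_n := 1%:M + k *: delta_mx i j.

Lemma transvectionD i j k c : i != j ->
  transvection i j k *m transvection i j c = transvection i j (k + c).
Proof.
move=> ij; rewrite /transvection mulmxDl mulmxDr !mul1mx -scalemxAl mulmxDr mulmx1.
rewrite -scalemxAr mul_delta_mx_cond eq_sym (negbTE ij) mulr0n scaler0 addr0.
by rewrite scalerDl -addrA [c *: _ + _]addrC.
Qed.

Lemma transvection0 i j : transvection i j 0 = 1%:M.
Proof. by rewrite /transvection scale0r addr0. Qed.

Lemma det_transvection i j k : i != j -> \det (transvection i j k) = 1.
Proof.
have lower (a b : 'I_n) : (b < a)%N -> \det (transvection a b k) = 1.
  move=> ba; rewrite det_trig.
    rewrite big1// => l _; rewrite !mxE eqxx; case: eqP => [->|]/=.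
      by case: eqP => [e|_]; [rewrite e ltnn in ba|rewrite mulr0 addr0].
    by rewrite mulr0 addr0.
  apply/is_trig_mxP => l m lm; rewrite !mxE.
  have -> : (l == m) = false by apply/negbTE; rewrite neq_ltn lm.
  case: eqP => [la|_]; case: eqP => [mb|_] /=; rewrite ?mulr0 ?addr0//.
  by move: lm; rewrite la mb ltnNge ltnW.
rewrite neq_ltn => /orP[ij|ji]; last exact: lower.
rewrite -det_tr (_ : _^T = transvection j i k); first exact: lower.
by rewrite /transvection linearD/= trmx1 linearZ/= trmx_delta.
Qed.

Lemma invmx_transvection i j k : i != j ->
  invmx (transvection i j k) = transvection i j (- k).
Proof.
move=> ij; have u : transvection i j k \in unitmx.
  by rewrite unitmxE det_transvection ?unitr1.
rewrite -[RHS]mul1mx -(mulVmx u) -mulmxA transvectionD// subrr transvection0.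
by rewrite mulmx1.
Qed.

(** The torus element diag (c^-1, c) of the SL2 on the coordinates i and j. *)
Definition cochar i j c : 'M[F]_n :=
  1%:M + (c^-1 - 1) *: delta_mx i i + (c - 1) *: delta_mx j j.

(** Both sides of [SL2_bruhat] are expanded with it, taking x y = -1. *)
Lemma SL2_bruhat_expand i j (x y : F) : i != j ->
  transvection i j x *m transvection j i y *m transvection i j x =
  1%:M + (x * y) *: delta_mx i i + (x * y) *: delta_mx j j +
  (x + x + x * y * x) *: delta_mx i j + y *: delta_mx j i.
Proof.
move=> ij; have ji : (j == i) = false by rewrite eq_sym; exact: negbTE.
have -> : transvection i j x *m transvection j i y =
    1%:M + y *: delta_mx j i + x *: delta_mx i j + (x * y) *: delta_mx i i.
  rewrite /transvection mulmxDl mul1mx mulmxDr mulmx1 -scalemxAl -scalemxAr.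
  by rewrite mul_delta_mx scalerA !addrA.
rewrite {1}/transvection mulmxDr mulmx1 !mulmxDl mul1mx -!scalemxAl -!scalemxAr.
rewrite !mul_delta_mx mul_delta_mx_0 ?ji// !scaler0 addr0 !scalerA.
apply/matrixP => k l; rewrite !mxE; ring.
Qed.

(** The matrix of SL2 with rows (0, -1/c) and (c, 0) is obtained from its value at
    c = 1 by the torus element diag (1/c, c). *)
Lemma SL2_bruhat i j c : i != j -> c != 0 ->
  transvection i j (- c^-1) *m transvection j i c *m transvection i j (- c^-1) =
  cochar i j c *m
    (transvection i j (- 1) *m transvection j i 1 *m transvection i j (- 1)).
Proof.
move=> ij c0; have ji : j != i by rewrite eq_sym.
rewrite !SL2_bruhat_expand// /cochar.
rewrite !mulmxDl !mul1mx -!scalemxAl !mulmxDr !mulmx1 -!scalemxAr.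
rewrite !mul_delta_mx !mul_delta_mx_0// !scaler0 !addr0.
move: 1%:M (delta_mx i i) (delta_mx j j) (delta_mx i j) (delta_mx j i) => I A B C D.
by apply/matrixP => k l; rewrite !mxE; field.
Qed.
End transvection.

Lemma transvection_SL4 (R : realType) (i j : 'I_4) (k : R) :
  i != j -> SL4 (transvection i j k).
Proof. exact: det_transvection. Qed.

Section generation.
Variable F : fieldType.

Lemma block_mx_transvection_dl n (i : 'I_n.+1) (k : F) :
  (block_mx 1%:M 0 (k *: delta_mx i 0) 1%:M : 'M[F]_(1 + n.+1)) =
  transvection (rshift 1 i) (lshift n.+1 0) k.
Proof.
rewrite /transvection (scalar_mx_block 1 n.+1) delta_mx_dshift delta_mx_lshift.
rewrite scale_col_mx scale_row_mx !scaler0 -(row_mx0 _ 1 1 n.+1) -block_mxEv.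
by rewrite add_block_mx !addr0 add0r.
Qed.

Lemma block_mx_transvection_ur n (i : 'I_n.+1) (k : F) :
  (block_mx 1%:M (k *: delta_mx 0 i) 0 1%:M : 'M[F]_(1 + n.+1)) =
  transvection (lshift n.+1 0) (rshift 1 i) k.
Proof.
rewrite /transvection (scalar_mx_block 1 n.+1) delta_mx_ushift delta_mx_rshift.
rewrite scale_col_mx scale_row_mx !scaler0 -(row_mx0 _ n.+1 1 n.+1) -block_mxEv.
by rewrite add_block_mx !addr0 add0r.
Qed.

Lemma block_mx_transvection_dr n (i j : 'I_n.+1) (k : F) :
  (block_mx 1%:M 0 0 (transvection i j k) : 'M[F]_(1 + n.+1)) =
  transvection (rshift 1 i) (rshift 1 j) k.
Proof.
rewrite /transvection (scalar_mx_block 1 n.+1) delta_mx_dshift delta_mx_rshift.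
rewrite scale_col_mx scale_row_mx !scaler0 -(row_mx0 _ 1 1 n.+1) -block_mxEv.
by rewrite add_block_mx !addr0.
Qed.

(** Gauss elimination.  A row operation brings the entry (0, 0) to 1; then
    A = [1 0; c 1] [1 0; 0 B] [1 r; 0 1] with B of determinant 1, and the outer
    factors are products of transvections. *)
Lemma SL_transvection_ind n (P : 'M[F]_n.+1 -> Prop) :
  (forall A B, P A -> P B -> P (A *m B)) ->
  (forall i j k, i != j -> P (transvection i j k)) ->
  P 1%:M -> forall A, \det A = 1 -> P A.
Proof.
elim: n P => [|n IH] P PM Pt P1 A detA.
  suff -> : A = 1%:M by [].
  by apply/matrixP => i j; rewrite !ord1 !mxE eqxx -detA det_mx11.
have Pr i j k B : i != j -> P (transvection i j k *m B) -> P B.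
  move=> ij PB; rewrite -[B]mul1mx -(transvection0 F i j) -(addNr k).
  by rewrite -transvectionD// -mulmxA; apply: (PM) => //; exact: Pt.
have entry i j k l B : (transvection i j k *m B) i l = B i l + k * B j l.
  rewrite mulmxDl mul1mx -scalemxAl !mxE (bigD1 j)//= big1 ?addr0 => [|m mj].
    by rewrite mxE !eqxx mul1r.
  by rewrite mxE (negbTE mj) andbF mul0r.
have pivot1 B : \det B = 1 -> B 0 0 = 1 -> P B.
  move=> detB B00.
  pose r := @ursubmx F 1 n.+1 1 n.+1 B; pose c := @dlsubmx F 1 n.+1 1 n.+1 B.
  pose B' := @drsubmx F 1 n.+1 1 n.+1 B - c *m r.
  have BE : B = (block_mx 1%:M 0 c 1%:M : 'M[F]_(1 + n.+1)) *m
     (block_mx 1%:M 0 0 B' : 'M[F]_(1 + n.+1)) *m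
     (block_mx 1%:M r 0 1%:M : 'M[F]_(1 + n.+1)).
    rewrite !mulmx_block !(mulmx0, mul0mx, mulmx1, mul1mx, addr0, add0r).
    rewrite /B' addrC subrK -[LHS](@submxK F 1 n.+1 1 n.+1).
    rewrite (_ : @ulsubmx F 1 n.+1 1 n.+1 B = 1%:M)//.
    by apply/matrixP => i j; rewrite !ord1 !mxE/= -B00; congr (B _ _); apply/val_inj.
  have detB' : \det B' = 1.
    move: detB; rewrite BE !(@det_mulmx F (1 + n.+1)) (@det_lblock F 1 n.+1).
    by rewrite !(@det_ublock F 1 n.+1) !det1 !mul1r mulr1.
  have PM' (C D : 'M[F]_(1 + n.+1)) : P C -> P D -> P (C *m D) by exact: PM.
  rewrite BE; apply: (PM' _ _ (PM' _ _ _ _)).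
  - rewrite (matrix_sum_delta c); under eq_bigr do rewrite big_ord1.
    elim/big_ind: _ => [|u v Pu Pv|i _]; first by rewrite -scalar_mx_block.
      have := PM' _ _ Pu Pv.
      by rewrite mulmx_block !(mulmx0, mul0mx, mulmx1, mul1mx, addr0, add0r).
    by rewrite block_mx_transvection_dl; apply: (Pt).
  - apply: (IH (fun B' => P (block_mx 1%:M 0 0 B' : 'M[F]_(1 + n.+1)))) => //.
    + move=> C D PC PD; have := PM' _ _ PC PD.
      by rewrite mulmx_block !(mulmx0, mul0mx, mulmx1, mul1mx, addr0, add0r).
    + move=> i j k ij; rewrite block_mx_transvection_dr; apply: (Pt).
      by apply: contraNneq ij => /(congr1 val)/= [/ord_inj ->].
    + by rewrite -scalar_mx_block.
  - rewrite (matrix_sum_delta r) big_ord1.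
    elim/big_ind: _ => [|u v Pu Pv|i _]; first by rewrite -scalar_mx_block.
      have := PM' _ _ Pv Pu.
      by rewrite mulmx_block !(mulmx0, mul0mx, mulmx1, mul1mx, addr0, add0r).
    by rewrite block_mx_transvection_ur; apply: (Pt).
have pivot B k : \det B = 1 -> k != 0 -> B k 0 != 0 -> P B.
  move=> detB k0 Bk0; rewrite eq_sym in k0.
  apply: (Pr 0 k ((1 - B 0 0) / B k 0)) => //; apply: pivot1.
    by rewrite det_mulmx det_transvection// mul1r.
  by rewrite entry divfK// addrC subrK.
have [[k /andP[k0 Ak]]|noA] := pselect (exists k, (k != 0) && (A k 0 != 0)).
  exact: pivot Ak.
have Ak k : k != 0 -> A k 0 = 0.
  by move=> k0; apply/eqP; apply: contra_notT noA => Ak; exists k; rewrite k0.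
have A00 : A 0 0 != 0.
  apply/eqP => A00; have : \det A = 0.
    rewrite (expand_det_col _ 0) big1// => k _.
    by have [->|/Ak ->] := eqVneq k 0; rewrite ?A00 mul0r.
  by rewrite detA => /eqP; rewrite oner_eq0.
(* Row 0 holds the only nonzero entry of column 0: copy it to row 1. *)
apply: (Pr 1 0 1) => //; apply: (@pivot _ 1) => //.
  by rewrite det_mulmx det_transvection// mul1r.
by rewrite entry Ak// add0r mul1r.
Qed.
End generation.

(** * Gradients and translations *)

(** M is the gradient at xi, for the trace form, of zeta |-> phi zeta v on sl4.
    Testing along curves avoids fixing an extension of phi outside sl4; M is only
    determined up to scalar matrices. *)
Definition gradient (R : realType) (n : nat) (phi : 'M[R]_4 -> 'rV[R]_n)
    (xi : 'M[R]_4) (v : 'cV[R]_n) (M : 'M[R]_4) : Prop :=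
  forall (gamma : R -> 'M[R]_4) (t : R) (D : 'M[R]_4),
    gamma t = xi -> (forall s, sl4 (gamma s)) -> mx_derive gamma t D ->
    is_derive t 1 (fun s => (phi (gamma s) *m v) 0 0) (\tr (M *m D)).

Section invariance.
Variables (R : realType) (n d : nat).
Variables (rho : 'M[R]_4 -> 'M[R]_n) (phi : 'M[R]_4 -> 'rV[R]_n).
Hypothesis rhoP : is_representation rho.
Hypothesis phi_poly : polynomial_map_le d phi.
Hypothesis phiP : forall xi, sl4 xi ->
  overalgebra_map phi @` coad_orbit xi =
  gplus_coad_orbit rho (overalgebra_map phi xi).

Implicit Types (xi M g : 'M[R]_4) (v : 'cV[R]_n) (i j : 'I_4).

Lemma phi_rho g xi : SL4 g -> sl4 xi ->
  phi xi *m rho g = phi (invmx g *m xi *m g).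
Proof.
move=> g1 xi0; have := phi_equivariant phiP (SL4V g1) xi0.
by rewrite invmxK.
Qed.

Lemma gradient_exists xi v : exists M, gradient phi xi v M.
Proof.
have [L hL] := polynomial_map_derive xi phi_poly.
exists (\sum_i v i 0 *: L i) => gamma t D gt g0 gD.
rewrite [X in is_derive _ _ X](_ : _ = fun s => \sum_i v i 0 * phi (gamma s) 0 i).
  rewrite mulmx_suml raddf_sum/=; apply: is_derive_sumT => i.
  by rewrite -scalemxAl mxtraceZ; apply: is_derive_mull; exact: hL.
by apply/funext => s; rewrite mxE; apply: eq_bigr => i _; rewrite mulrC.
Qed.

Lemma gradient_lin xi v w M N (k : R) : gradient phi xi v M ->
  gradient phi xi w N -> gradient phi xi (v + k *: w) (M + k *: N).
Proof.
move=> vM wN gamma t D gt g0 gD.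
rewrite [X in is_derive _ _ X](_ : _ =
  (fun s => (phi (gamma s) *m v) 0 0) \+ (fun s => k * (phi (gamma s) *m w) 0 0)).
  rewrite mulmxDl mxtraceD -scalemxAl mxtraceZ.
  by apply: is_deriveD; [exact: vM|apply: is_derive_mull; exact: wN].
by apply/funext => s; rewrite mulmxDr -scalemxAr mxE [X in _ + X]mxE.
Qed.

Lemma gradientZ xi v M (k : R) : gradient phi xi v M ->
  gradient phi xi (k *: v) (k *: M).
Proof.
move=> vM gamma t D gt g0 gD.
rewrite [X in is_derive _ _ X](_ : _ = (fun s => k * (phi (gamma s) *m v) 0 0)).
  by rewrite -scalemxAl mxtraceZ; apply: is_derive_mull; exact: vM.
by apply/funext => s; rewrite -scalemxAr mxE.
Qed.

Lemma gradient_conj xi v M g : SL4 g -> gradient phi (invmx g *m xi *m g) v M ->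
  gradient phi xi (rho g *m v) (g *m M *m invmx g).
Proof.
move=> g1 vM gamma t D gt g0 gD.
rewrite [X in is_derive _ _ X](_ : _ =
  fun s => (phi (invmx g *m gamma s *m g) *m v) 0 0); last first.
  by apply/funext => s; rewrite mulmxA phi_rho.
rewrite -!mulmxA mxtrace_mulC -!mulmxA mulmxA.
rewrite (_ : \tr _ = \tr (M *m (invmx g *m D *m g))); last by rewrite !mulmxA.
apply: (vM (fun s => invmx g *m gamma s *m g)).
- by rewrite gt.
- by move=> s; have := sl4_conj (SL4V g1) (g0 s); rewrite invmxK.
- have := mx_deriveM (mx_deriveM (mx_derive_cst (invmx g) t) gD) (mx_derive_cst g t).
  by rewrite mul0mx add0r mulmx0 addr0.
Qed.

(** The translation by [M, xi]: by equivariance, phi xi rho'(X) v is the derivative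
    of phi along t |-> exp (-t X) xi exp (t X), that is tr (M [xi, X]), and this is
    tr ([M, xi] X). *)
Lemma phi_gradient_flow xi v M : sl4 xi -> gradient phi xi v M ->
  phi (xi + (M *m xi - xi *m M)) = phi xi.
Proof.
move=> xi0 vM; apply: (phi_translation rhoP phiP (v := v)) => //.
  by rewrite /sl4/= linearB/= mxtrace_mulC subrr.
move=> X D X0 dD.
pose c (s : R) := expmx (- s *: X) *m xi *m expmx (s *: X).
have h1 : is_derive (0 : R) 1 (fun s => (phi (c s) *m v) 0 0)
    (\tr (M *m (xi *m X - X *m xi))).
  apply: (vM c); rewrite /c.
  - by rewrite oppr0 !scale0r expmx0 mul1mx mulmx1.
  - move=> s; have := sl4_conj (SL4V (SL4_expmx s X0)) xi0.
    by rewrite invmxK invmx_expmx.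
  - have dN : mx_derive (fun s => expmx (- s *: X)) 0 (- X).
      apply: (mx_derive_reflect (M := fun s => expmx (s *: X))).
      by have := expmx_derivel X (- 0); rewrite oppr0 scale0r expmx0 mulmx1.
    have := mx_deriveM (mx_deriveM dN (mx_derive_cst xi 0)) (expmx_derivel X 0).
    rewrite oppr0 scale0r expmx0 mulmx0 addr0 !mulmx1 mul1mx addrC mulNmx.
    exact.
have h2 : is_derive (0 : R) 1 (fun s => (phi xi *m rho (expmx (s *: X)) *m v) 0 0)
    ((phi xi *m D *m v) 0 0).
  have := mx_deriveM (mx_deriveM (mx_derive_cst (phi xi) 0) dD) (mx_derive_cst v 0).
  by rewrite mul0mx add0r mulmx0 addr0 => /(_ 0 0).
rewrite -(derive_val (is_derive := h2)).
rewrite (_ : (fun s => _) = (fun s => (phi (c s) *m v) 0 0)); last first.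
  apply/funext => s; rewrite /c phi_rho ?invmx_expmx//; exact: SL4_expmx.
rewrite (derive_val (is_derive := h1)).
rewrite mulmxBl mulmxBr !raddfB/= !mulmxA; congr (_ - _).
by rewrite [LHS]mxtrace_mulC mulmxA [LHS]mxtrace_mulC mulmxA.
Qed.

End invariance.

(** * Root subgroups fixing the value at a regular diagonal matrix *)

Section diagonal.
Variables (R : realType) (n d : nat).
Variables (rho : 'M[R]_4 -> 'M[R]_n) (phi : 'M[R]_4 -> 'rV[R]_n).
Hypothesis rhoP : is_representation rho.
Hypothesis phi_poly : polynomial_map_le d phi.
Hypothesis phiP : forall xi, sl4 xi ->
  overalgebra_map phi @` coad_orbit xi =
  gplus_coad_orbit rho (overalgebra_map phi xi).

Variable a : 'rV[R]_4.
Let xi := diag_mx a.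
Hypothesis xi0 : sl4 xi.
Hypothesis a_inj : forall i j, i != j -> a 0 i != a 0 j.

Lemma mxE_diag_conj (b : 'rV[R]_4) (M : 'M[R]_4) i j :
  diag_mx b \in unitmx ->
  (diag_mx b *m M *m invmx (diag_mx b)) i j = b 0 i / b 0 j * M i j.
Proof.
move=> bU; set N := _ *m invmx _.
have : N *m diag_mx b = diag_mx b *m M by rewrite mulmxKV.
move=> /matrixP/(_ i j); rewrite mul_mx_diag mul_diag_mx !mxE => h.
have bj : b 0 j != 0.
  move: bU; rewrite unitmxE det_diag unitfE => /prodf_neq0; exact.
by rewrite mulrAC -h mulfK.
Qed.

(** Let g be diagonal with entries 2 at j, 1/2 at i and 1 elsewhere.  Conjugation
    by g acts on E_kl by one of the scalars 4, 2, 1, 1/2, 1/4, and by 4 only on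
    E_ji.  Since g fixes xi, gradients are stable under it, hence under the
    polynomial in it that vanishes at 2, 1, 1/2 and 1/4. *)
Lemma gradient_root i j v M : i != j -> gradient phi xi v M ->
  exists w, gradient phi xi w (M j i *: delta_mx j i).
Proof.
move=> ij vM.
pose b : 'rV[R]_4 := \row_k (if k == j then 2 else if k == i then 2^-1 else 1).
pose g := diag_mx b.
have g1 : SL4 g.
  rewrite /SL4/= det_diag (bigD1 j)//= (bigD1 i)//= !mxE eqxx (negbTE ij) eqxx.
  rewrite big1 ?mulr1 ?divff// => k /andP[kj ki].
  by rewrite mxE (negbTE kj) (negbTE ki).
have gxi : invmx g *m xi *m g = xi.
  by rewrite -mulmxA (diag_mxC a b) mulKmx//; exact: SL4_unit.
have step (mu : R) w N : gradient phi xi w N ->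
    gradient phi xi (rho g *m w + (- mu) *: w) (g *m N *m invmx g + (- mu) *: N).
  move=> wN; apply: gradient_lin => //; apply: (gradient_conj phiP) => //.
  by rewrite gxi.
have := step 4^-1 _ _ (step 2^-1 _ _ (step 1 _ _ (step 2 _ _ vM))).
set w := (X in gradient _ _ X); set N := (X in gradient _ _ _ X) => wN.
(* (4 - 2) (4 - 1) (4 - 1/2) (4 - 1/4) = 315 / 4 *)
exists ((4 / 315) *: w).
have -> : M j i *: delta_mx j i = (4 / 315) *: N; last exact: gradientZ.
apply/matrixP => k l; have gU := SL4_unit g1.
rewrite /N !(mxE_diag_conj, mxE)//.
have [->|kj] := eqVneq k j; have [->|li] := eqVneq l i;
  rewrite ?eqxx ?(negbTE kj) ?(negbTE li) ?(negbTE ij) /=.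
- by field.
- by case: (l == j); field.
- by case: (k == i); field.
- by case: (k == i); case: (l == j); field.
Qed.

(** Shows that the line xi + R E_ij lies in the orbit of xi, when a_i <> a_j. *)
Lemma transvection_conj i j (k : R) : i != j ->
  invmx (transvection i j k) *m xi *m transvection i j k =
  xi + (k * (a 0 i - a 0 j)) *: delta_mx i j.
Proof.
move=> ij; rewrite invmx_transvection//.
have dx : delta_mx i j *m xi = a 0 j *: delta_mx i j.
  apply/matrixP => p q; rewrite mul_mx_diag !mxE mulrC.
  by case: (eqVneq q j) => [->//|_]; rewrite andbF !mulr0.
have xd : xi *m delta_mx i j = a 0 i *: delta_mx i j.
  apply/matrixP => p q; rewrite mul_diag_mx !mxE.
  by case: (eqVneq p i) => [->//|_]; rewrite !mulr0.
rewrite /transvection mulmxDl mul1mx -scalemxAl dx mulmxDr mulmx1.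
rewrite -scalemxAr mulmxDl xd -!scalemxAl mul_delta_mx_0 1?eq_sym// !scaler0 addr0.
by apply/matrixP => p q; rewrite !mxE; ring.
Qed.

Lemma transvection_rootP i j : i != j ->
  (forall c, phi (xi + c *: delta_mx i j) = phi xi) <->
  (forall k, phi xi *m rho (transvection i j k) = phi xi).
Proof.
move=> ij; have aij : a 0 i - a 0 j != 0 by rewrite subr_eq0 a_inj.
have pr k : phi xi *m rho (transvection i j k) =
    phi (xi + (k * (a 0 i - a 0 j)) *: delta_mx i j).
  by rewrite (phi_rho phiP) ?transvection_conj//; exact: transvection_SL4.
split=> [h k|h c]; first by rewrite pr h.
by rewrite -[RHS](h (c / (a 0 i - a 0 j))) pr divfK.
Qed.

(** If E_ji is a gradient up to a scalar, then [E_ji, xi] is a nonzero multiple of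
    E_ji and phi is constant on xi + R E_ji by [phi_gradient_flow].  Otherwise
    the derivative of phi along xi + R E_ij vanishes at xi, and equivariance
    carries this to every point of the line. *)
Lemma root_dichotomy i j : i != j ->
  (forall k, phi xi *m rho (transvection j i k) = phi xi) \/
  (forall k, phi xi *m rho (transvection i j k) = phi xi).
Proof.
move=> ij; have ji : j != i by rewrite eq_sym.
have aij : a 0 i - a 0 j != 0 by rewrite subr_eq0 a_inj.
have [[v [M [vM Mji]]]|noM] := pselect (exists v M, gradient phi xi v M /\ M j i != 0).
  left; apply/transvection_rootP => // c.
  have [w wM] := gradient_root ij vM.
  pose k := c / (M j i * (a 0 i - a 0 j)).
  have := phi_gradient_flow rhoP phiP xi0 (gradientZ k wM).
  move=> <-; congr (phi (_ + _)); apply/matrixP => p q.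
  rewrite mul_mx_diag mul_diag_mx !mxE.
  case: (eqVneq p j) => [->|_]/=; last by rewrite !mulr0 mul0r subrr.
  case: (eqVneq q i) => [->|_]/=; last by rewrite !mulr0 mul0r subrr.
  by rewrite /k; field; rewrite Mji aij.
right; apply/transvection_rootP => // c.
have line0 s : sl4 (xi + s *: delta_mx i j).
  by rewrite /sl4/= mxtraceD xi0 add0r; exact: sl4_delta.
have dline (s0 : R) : mx_derive (fun s => xi + s *: delta_mx i j) s0 (delta_mx i j).
  rewrite -[X in mx_derive _ _ X]add0r.
  by apply: mx_deriveD; [exact: mx_derive_cst|exact: mx_derive_scale].
have d0 (v : 'cV[R]_n) :
    is_derive (0 : R) 1 (fun s => (phi (xi + s *: delta_mx i j) *m v) 0 0) 0.
  have [M vM] := gradient_exists phi_poly xi v.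
  have Mji : M j i = 0.
    by apply/eqP; apply: contra_notT noM => Mji; exists v, M.
  have := vM _ 0 (delta_mx i j) _ line0 (dline 0).
  rewrite scale0r addr0 => /(_ erefl).
  rewrite mxtrace_mulC (_ : \tr _ = M j i) ?Mji//.
  rewrite /mxtrace (bigD1 i)//= big1 ?addr0 => [|p pi].
    rewrite mxE (bigD1 j)//= big1 ?addr0 => [|q qj].
      by rewrite mxE !eqxx mul1r.
    by rewrite mxE (negbTE qj) andbF mul0r.
  by rewrite mxE big1// => q _; rewrite mxE (negbTE pi) mul0r.
apply/matrixP => p q; rewrite ord1.
have phiE s : phi (xi + s *: delta_mx i j) 0 q =
    (phi (xi + s *: delta_mx i j) *m (delta_mx q 0 : 'cV[R]_n)) 0 0.
  rewrite mxE (bigD1 q)//= big1 ?addr0 => [|r rq]; first by rewrite mxE !eqxx mulr1.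
  by rewrite mxE (negbTE rq) mulr0.
rewrite -[in RHS](addr0 xi) -(scale0r (delta_mx i j)).
apply: (@is_derive_0_is_cst _ (fun s => phi (xi + s *: delta_mx i j) 0 q)) => s.
pose g := transvection i j (s / (a 0 i - a 0 j)).
have g1 : SL4 g by exact: transvection_SL4.
have gE h : phi (xi + (h + s) *: delta_mx i j) = phi (xi + h *: delta_mx i j) *m rho g.
  rewrite (phi_rho phiP)//; congr phi.
  rewrite (mulmxDr (invmx g)) (mulmxDl _ _ g) transvection_conj// divfK//.
  rewrite -scalemxAr -scalemxAl.
  rewrite invmx_transvection// /g /transvection mulmxDl mul1mx -scalemxAl.
  rewrite mul_delta_mx_0 1?eq_sym// scaler0 addr0.
  rewrite mulmxDr mulmx1 -scalemxAr mul_delta_mx_0 1?eq_sym// scaler0 addr0.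
  by rewrite scalerDl addrAC addrA.
have := d0 (rho g *m (delta_mx q 0 : 'cV[R]_n)).
rewrite (_ : (fun _ => _) = fun h => phi (xi + (h + s) *: delta_mx i j) 0 q); last first.
  by apply/funext => h; rewrite phiE gE mulmxA.
move=> dh.
have ds : is_derive s (1 : R) (shift (- s)) (1 : R) := is_derive_shift s 1 (- s).
have dh' : is_derive (shift (- s) s) 1
    (fun h => phi (xi + (h + s) *: delta_mx i j) 0 q) 0.
  by rewrite /= subrr.
have := is_derive1_comp dh' ds.
rewrite mul0r; congr is_derive.
by apply/funext => h /=; rewrite subrK.
Qed.

End diagonal.


Section diagonal_invariance.
Variables (R : realType) (n d : nat).
Variables (rho : 'M[R]_4 -> 'M[R]_n) (phi : 'M[R]_4 -> 'rV[R]_n).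
Hypothesis rhoP : is_representation rho.
Hypothesis phi_poly : polynomial_map_le d phi.
Hypothesis phiP : forall xi, sl4 xi ->
  overalgebra_map phi @` coad_orbit xi =
  gplus_coad_orbit rho (overalgebra_map phi xi).

Let rhoM g h : SL4 g -> SL4 h -> rho (g *m h) = rho g *m rho h.
Proof. by case: rhoP => _ + _; exact. Qed.

Variable a : 'rV[R]_4.
Let xi := diag_mx a.
Hypothesis xi0 : sl4 xi.
Hypothesis a_inj : forall i j, i != j -> a 0 i != a 0 j.

(** Write the lower transvection as u(1/c) h(c) w u(1/c) with h(c) in the torus
    (SL2_bruhat).  Since f is fixed by u and by h, its image under the lower
    transvection of parameter c, a polynomial in c, is also a polynomial in
    1/c: it is constant. *)
Lemma root_symmetric i j : i != j ->
  (forall k, phi xi *m rho (transvection i j k) = phi xi) ->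
  forall k, phi xi *m rho (transvection j i k) = phi xi.
Proof.
move=> ij fix_ij; have ji : j != i by rewrite eq_sym.
apply/(transvection_rootP phiP xi0 a_inj ji).
pose w : 'M[R]_4 :=
  transvection i j (- 1) *m transvection j i 1 *m transvection i j (- 1).
have w1 : SL4 w.
  do 2 (apply: SL4M; last exact: transvection_SL4).
  exact: transvection_SL4.
have cochar_SL4 (c : R) : c != 0 -> SL4 (cochar i j c).
  move=> c0; have := congr1 determinant (SL2_bruhat ij c0).
  by rewrite !det_mulmx !det_transvection// !mulr1.
have fix_cochar (c : R) : c != 0 -> phi xi *m rho (cochar i j c) = phi xi.
  move=> c0; have K1 := cochar_SL4 c c0; rewrite (phi_rho phiP)//.
  suff xiK : xi *m cochar i j c = cochar i j c *m xi.
    by rewrite -mulmxA xiK mulKmx//; exact: SL4_unit.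
  apply/matrixP => p q; rewrite mul_diag_mx mul_mx_diag !mxE.
  case: (eqVneq p q) => [->|pq]; first by rewrite mulrC.
  have off k : (p == k) && (q == k) = false.
    by apply/negP => /andP[/eqP pk /eqP qk]; rewrite pk qk eqxx in pq.
  by rewrite !off !mulr0 !addr0 mulr0 mul0r.
pose E : 'M[R]_4 := delta_mx i j.
have [zeta zetaE] : exists z, invmx w *m xi *m w = z by exists (invmx w *m xi *m w).
have zeta0 : sl4 zeta by have := sl4_conj (SL4V w1) xi0; rewrite invmxK zetaE.
have fix_E (c : R) : c != 0 -> phi (xi + c *: ((a 0 j - a 0 i) *: delta_mx j i)) =
    phi (zeta + c^-1 *: (zeta *m E - E *m zeta) + c^-1 ^+ 2 *: - (E *m zeta *m E)).
  move=> c0; rewrite scalerA -transvection_conj// -(phi_rho phiP)//; last first.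
    exact: transvection_SL4.
  have -> : transvection j i c =
      transvection i j c^-1 *m (cochar i j c *m w *m transvection i j c^-1).
    rewrite -SL2_bruhat// -!mulmxA transvectionD// addNr transvection0 mulmx1.
    by rewrite mulmxA transvectionD// subrr transvection0 mul1mx.
  rewrite rhoM; last 2 first.
  - exact: transvection_SL4.
  - apply: SL4M; last exact: transvection_SL4.
    by apply: SL4M => //; exact: cochar_SL4.
  rewrite mulmxA fix_ij rhoM; last 2 first.
  - by apply: SL4M => //; exact: cochar_SL4.
  - exact: transvection_SL4.
  rewrite mulmxA rhoM// ?mulmxA; last exact: cochar_SL4.
  rewrite fix_cochar// (phi_rho phiP)// zetaE (phi_rho phiP)//; last first.
    exact: transvection_SL4.
  congr (phi _); rewrite invmx_transvection// /transvection -/E.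
  rewrite mulmxDl mul1mx -scalemxAl mulmxDr mulmx1 -!scalemxAr mulmxDl -!scalemxAl.
  move: (zeta *m E) (E *m zeta) (E *m zeta *m E) => A B C.
  apply/matrixP => p q; rewrite !mxE; ring.
have C0 : sl4 (- (E *m zeta *m E)).
  rewrite /sl4/= linearN/= mxtrace_mulC mulmxA mul_delta_mx_0//.
  by rewrite mul0mx linear0 oppr0.
have B0 : sl4 (zeta *m E - E *m zeta).
  by rewrite /sl4/= linearB/= mxtrace_mulC subrr.
have D0 : sl4 ((a 0 j - a 0 i) *: delta_mx j i : 'M[R]_4) by exact: sl4_delta.
move=> c; apply/matrixP => p q; rewrite ord1.
have [P PE] := polynomial_map_poly phi_poly xi0 D0 (mxtrace0 R 4) q.
have [Q QE] := polynomial_map_poly phi_poly zeta0 B0 C0 q.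
have PQ x : x != 0 -> P.[x] = Q.[x^-1].
  by move=> x0; rewrite -PE -QE scaler0 addr0 fix_E.
have aji : a 0 j - a 0 i != 0 by rewrite subr_eq0 a_inj.
have := PE (c / (a 0 j - a 0 i)); rewrite scaler0 addr0 scalerA divfK// => ->.
have := PE 0; rewrite scaler0 addr0 scale0r addr0 => ->.
exact: poly_inv_const PQ _.
Qed.

Lemma phi_invariant_diag g : SL4 g -> phi (g *m xi *m invmx g) = phi xi.
Proof.
move=> g1; rewrite (phi_equivariant phiP)//; move: (SL4V g1).
have tvfix i j k : i != j -> phi xi *m rho (transvection i j k) = phi xi.
  move=> ij; have [h|h] := root_dichotomy rhoP phi_poly phiP xi0 a_inj ij.
    by apply: root_symmetric => //; rewrite eq_sym.
  exact: h.
move: (invmx g).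
suff H (h : 'M[R]_4) : \det h = 1 -> SL4 h /\ phi xi *m rho h = phi xi.
  by move=> h /H[].
apply: (SL_transvection_ind (P := fun h => SL4 h /\ phi xi *m rho h = phi xi)).
- move=> A B [A1 fA] [B1 fB]; split; first exact: SL4M.
  by rewrite rhoM// mulmxA fA.
- by move=> i j k ij; split; [exact: transvection_SL4|exact: tvfix].
- split; first exact: SL4_1.
  by case: rhoP => -> _ _; rewrite mulmx1.
Qed.

End diagonal_invariance.

(** * Convex hulls of regular diagonal orbits *)

Section hull.
Variables (R : realType) (a : 'rV[R]_4).
Let xi := diag_mx a.
Hypothesis xi0 : sl4 xi.
Hypothesis a_inj : forall i j, i != j -> a 0 i != a 0 j.

(** The set D of directions Y with xi + R Y in C is a subspace, because C is stable
    under midpoints.  It contains every E_ij with i <> j, since the line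
    xi + R E_ij lies in the orbit.  It also contains E_jj - E_ii modulo these: conjugating the line by
    1 + E_ji gives a line of direction E_ij + E_jj - E_ii - E_ji through a point
    of xi + R E_ji.  So D contains sl4. *)
Lemma midpoint_orbit_sl4 (C : set 'M[R]_4) :
  (forall X Y, C X -> C Y -> C (2^-1 *: X + 2^-1 *: Y)) ->
  coad_orbit xi `<=` C -> forall X, sl4 X -> C X.
Proof.
move=> mid orbC.
pose D (Y : 'M[R]_4) := forall s : R, C (xi + s *: Y).
have DD Y Z : D Y -> D Z -> D (Y + Z).
  move=> DY DZ s; have := mid _ _ (DY (2 * s)) (DZ (2 * s)).
  by congr C; apply/matrixP => i j; rewrite !mxE; field.
have DZ (k : R) Y : D Y -> D (k *: Y).
  by move=> DY s; rewrite scalerA; exact: DY.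
have D0 : D 0.
  move=> s; rewrite scaler0 addr0; apply: orbC; exists 1%:M; first exact: SL4_1.
  by rewrite invmx1 mul1mx mulmx1.
have Dij i j : i != j -> D (delta_mx i j).
  move=> ij s; apply: orbC.
  have aij : a 0 i - a 0 j != 0 by rewrite subr_eq0 a_inj.
  exists (transvection i j (- (s / (a 0 i - a 0 j)))); first exact: transvection_SL4.
  rewrite invmx_transvection// opprK -(invmx_transvection _ ij).
  by rewrite transvection_conj// divfK.
have Dii i j : i != j -> D (delta_mx j j - delta_mx i i).
  move=> ij; have ji : j != i by rewrite eq_sym.
  pose M : 'M[R]_4 := delta_mx i j + delta_mx j j - delta_mx i i - delta_mx j i.
  suff DM : D M.
    have -> : delta_mx j j - delta_mx i i =
        M + (-1) *: delta_mx i j + delta_mx j i :> 'M[R]_4.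
      by apply/matrixP => p q; rewrite !mxE; ring.
    exact: (DD _ _ (DD _ _ DM (DZ _ _ (Dij _ _ ij))) (Dij _ _ ji)).
  move=> s.
  have aij : a 0 i - a 0 j != 0 by rewrite subr_eq0 a_inj.
  pose u := transvection j i (1 : R); pose k := - (a 0 j - a 0 i).
  have C1 : C (xi + k *: delta_mx j i + (2 * s) *: M).
    apply: orbC; pose g := transvection i j (- ((2 * s) / (a 0 i - a 0 j))).
    exists (u *m g); first by apply: SL4M; exact: transvection_SL4.
    have gE : g *m xi *m invmx g = xi + (2 * s) *: delta_mx i j.
      rewrite /g invmx_transvection// opprK -(invmx_transvection _ ij).
      by rewrite transvection_conj// divfK.
    have uE : u *m xi *m invmx u = xi + k *: delta_mx j i.
      rewrite /k -mulN1r -(transvection_conj a (-1) ji) /u.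
      by rewrite !invmx_transvection// opprK.
    have ug : invmx (u *m g) = invmx g *m invmx u.
      have uU : u \in unitmx by rewrite unitmxE det_transvection ?unitr1.
      have gU : g \in unitmx by rewrite unitmxE det_transvection ?unitr1.
      by rewrite -[LHS]/((u * g)^-1) invrM.
    rewrite ug !mulmxA -(mulmxA u) -(mulmxA u) gE mulmxDr mulmxDl uE; congr (_ + _).
    rewrite -scalemxAr -scalemxAl; congr (_ *: _).
    rewrite invmx_transvection// /u /transvection scale1r scaleN1r.
    rewrite !(mulmxDl, mulmxDr, mulmxN, mulNmx, mul1mx, mulmx1, mul_delta_mx).
    by apply/matrixP => p q; rewrite !mxE; ring.
  have := mid _ _ C1 (Dij _ _ ji (- k)).
  by congr C; apply/matrixP => p q; rewrite !mxE; field.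
move=> X X0; rewrite -(subrKC xi X) -[X - xi]scale1r; move: 1.
suff: D (X - xi) by [].
have : sl4 (X - xi) by rewrite /sl4/= linearB/= X0 xi0 subrr.
move: (X - xi) => {X0}X X0.
have -> : X = \sum_i \sum_j (X i j *: (delta_mx i j - (i == j)%:R *: delta_mx 0 0)).
  rewrite {1}(matrix_sum_delta X).
  under [RHS]eq_bigr do under eq_bigr do rewrite scalerBr scalerA.
  under [RHS]eq_bigr do rewrite sumrB.
  rewrite sumrB [X in _ - X](_ : _ = 0) ?subr0//.
  under eq_bigr => i _.
    rewrite (bigD1 i)//= big1 ?addr0 => [|j ji]; last first.
      by rewrite eq_sym (negbTE ji) mulr0 scale0r.
    rewrite eqxx mulr1.
    over.
  by rewrite -scaler_suml (_ : \sum_i X i i = 0) ?scale0r.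
elim/big_ind: _ => // i _; elim/big_ind: _ => // j _; apply: (DZ).
have [<-|ij] := eqVneq i j; last by rewrite scale0r subr0; exact: Dij.
rewrite scale1r; have [->|i0] := eqVneq i 0; first by rewrite subrr.
by apply: Dii; rewrite eq_sym.
Qed.

End hull.

Section regular_orbit.
Variables (R : realType) (a : 'rV[R]_4).
Hypothesis a0 : sl4 (diag_mx a).
Hypothesis a_inj : forall i j, i != j -> a 0 i != a 0 j.

(** The hull retains nothing of the orbit but the value f of phi on it. *)
Lemma hull_orbit (n : nat) (phi : 'M[R]_4 -> 'rV[R]_n) (f : 'rV[R]_n) :
  (forall X, coad_orbit (diag_mx a) X -> phi X = f) ->
  smallest (@convex_set R ('M[R]_4 * 'rV[R]_n)%type)
    (overalgebra_map phi @` coad_orbit (diag_mx a)) =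
  [set Z | sl4 Z.1 /\ Z.2 = f].
Proof.
move=> phif; apply/seteqP; split.
  apply: smallest_sub.
    move=> X Y t; rewrite !inE => -[X0 Xf] [Y0 Yf].
    split=> /=; last by rewrite Xf Yf -scalerDl addrC subrK scale1r.
    by rewrite /sl4/= mxtraceD !mxtraceZ X0 Y0 !mulr0 addr0.
  move=> _ [X aX <-]; split=> /=; last exact: phif.
  by case: aX => g g1 <-; exact: sl4_conj.
move=> [X _] /= [X0 ->] B [convB orbB].
apply: (midpoint_orbit_sl4 a0 a_inj (C := fun X => B (X, f))) => //.
- move=> Y Z BY BZ.
  have half1 : 2^-1 <= 1 :> R by rewrite invf_le1// ler1n.
  have half : 1 - 2^-1 = 2^-1 :> R by lra.
  have : B (2^-1 *: Y + (1 - 2^-1) *: Z, 2^-1 *: f + (1 - 2^-1) *: f).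
    have := convB (Y, f) (Z, f) (Itv01 (eqbRL (invr_ge0 _) (ler0n _ 2)) half1).
    by rewrite !inE => /(_ BY BZ).
  by rewrite half -scalerDl (_ : 2^-1 + 2^-1 = 1) ?scale1r//; lra.
- by move=> Y aY; apply: orbB; exists Y => //; rewrite /overalgebra_map phif.
Qed.

Lemma generic_diag : generic (diag_mx a).
Proof.
split=> //; exists [seq (real_complex R) (a 0 i) | i <- enum 'I_4]; split.
- by rewrite size_map size_enum_ord.
- rewrite map_inj_in_uniq ?enum_uniq// => i j _ _ /complexI aij.
  by apply/eqP; apply: contraPT aij => /a_inj/eqP.
- move=> _ /mapP[i _ ->]; apply/eigenvalueP; exists (delta_mx 0 i); last first.
    apply/negP => /eqP/matrixP/(_ 0 i); rewrite !mxE !eqxx/=.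
    by move=> /eqP; rewrite oner_eq0.
  rewrite map_diag_mx; apply/matrixP => p q; rewrite mul_mx_diag !mxE mulrC.
  by case: (eqVneq q i) => [->//|_]; rewrite andbF !mulr0.
Qed.

(** A permutation matrix may have determinant -1; a sign on the first coordinate,
    which commutes with diagonal matrices, corrects it. *)
Lemma diag_perm_orbit (s : 'S_4) :
  coad_orbit (diag_mx a) (diag_mx (\row_i a 0 (s i))).
Proof.
pose e : 'rV[R]_4 := \row_i (if i == 0 then (-1) ^+ s else 1).
pose g : 'M[R]_4 := perm_mx s *m diag_mx e.
have g1 : SL4 g.
  rewrite /SL4/= det_mulmx det_perm det_diag (bigD1 0)//= mxE eqxx.
  by rewrite big1 ?mulr1 -?signr_addb ?addbb// => i i0; rewrite mxE (negbTE i0).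
exists g => //; rewrite -[RHS](mulmxK (SL4_unit g1)); congr (_ *m _).
rewrite /g -mulmxA (diag_mxC e a) mulmxA [RHS]mulmxA; congr (_ *m _).
rewrite -row_permE; apply/matrixP => p q; rewrite mul_diag_mx !mxE.
by case: eqP => [->|]; rewrite ?mulr1 ?mulr0.
Qed.

End regular_orbit.

(** * A one-parameter family of orbits that cubic maps do not separate *)

Section pairs.
Variable R : realType.

(** Their characteristic polynomial (X^2 - x^2) (X^2 - y^2) has no terms of degree 3
    and 1, so that an invariant of degree at most 3 is an affine function of
    x^2 + y^2 on this family. *)
Definition pairs (x y : R) : 'rV[R]_4 := \row_(i < 4) [:: x; - x; y; - y]`_i.

Lemma pairs_sl4 x y : sl4 (diag_mx (pairs x y)).
Proof.
rewrite /sl4/= mxtrace_diag; rewrite !big_ord_recl big_ord0 !mxE/=; ring.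
Qed.

Lemma det_pairs x y : \det (diag_mx (pairs x y)) = x ^+ 2 * y ^+ 2.
Proof. rewrite det_diag !big_ord_recl big_ord0 !mxE/=; ring. Qed.

Lemma pairs_inj x y : x != 0 -> y != 0 -> x != y -> x != - y ->
  forall i j, i != j -> pairs x y 0 i != pairs x y 0 j.
Proof.
move=> x0 y0 xy xNy i j; apply: contraNN; rewrite !mxE.
rewrite (nth_uniq 0) ?ltn_ord//= !inE !negb_or.
have N (z : R) : z != 0 -> z != - z.
  by move=> z0; apply: contraNneq z0 => zN; apply/eqP; lra.
by rewrite !N// xy xNy eqr_opp xy eqr_oppLR xNy.
Qed.

(** The sum over the dihedral group of order 8 that the sign changes and the
    exchange generate. *)
Definition average (q : R -> R -> R) (x y : R) :=
  q x y + q (- x) y + q x (- y) + q (- x) (- y) +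
  (q y x + q (- y) x + q y (- x) + q (- y) (- x)).

(** The entries of diag (x, -x, y, -y) are multiples of x or of y, zero included. *)
Lemma monomial_pairs (I : eqType) (r : seq I) (l : I -> R -> R -> R)
    (m : I -> nat) :
  (forall i, exists k a b, (a + b)%N = 1%N /\
    forall x y, l i x y = k * x ^+ a * y ^+ b) ->
  exists k a b, (a + b)%N = (\sum_(i <- r) m i)%N /\
    forall x y, \prod_(i <- r) l i x y ^+ m i = k * x ^+ a * y ^+ b.
Proof.
move=> lE; elim: r => [|i r [k [a [b [ab IH]]]]].
  by exists 1, 0%N, 0%N; split=> [|x y]; rewrite !big_nil ?mulr1.
have [k' [a' [b' [ab' lE']]]] := lE i.
exists (k' ^+ m i * k), (a' * m i + a)%N, (b' * m i + b)%N; split=> [|x y].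
  by rewrite big_cons -ab addnACA -mulnDl ab' mul1n.
rewrite big_cons IH lE' !exprMn !exprD !exprM.
move: (k' ^+ _) ((x ^+ a') ^+ _) ((y ^+ b') ^+ _) => A B C; ring.
Qed.

Lemma average_monomial (k : R) (a b : nat) : (a + b <= 3)%N ->
  exists A B, forall x y,
    average (fun x y => k * x ^+ a * y ^+ b) x y = A + B * (x ^+ 2 + y ^+ 2).
Proof.
case: a => [|[|[|[|a]]]]; case: b => [|[|[|[|b]]]] // _; rewrite /average.
- exists (8 * k), 0 => x y; ring.
- exists 0, 0 => x y; ring.
- exists 0, (4 * k) => x y; ring.
- exists 0, 0 => x y; ring.
- exists 0, 0 => x y; ring.
- exists 0, 0 => x y; ring.
- exists 0, 0 => x y; ring.
- exists 0, (4 * k) => x y; ring.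
- exists 0, 0 => x y; ring.
- exists 0, 0 => x y; ring.
Qed.

(** Term by term: among the monomials of degree at most 3, only 1, x^2 and y^2
    have a nonzero average. *)
Lemma average_polynomial n (phi : 'M[R]_4 -> 'rV[R]_n) (i : 'I_n) :
  polynomial_map_le 3 phi -> exists A B, forall x y,
    average (fun x y => phi (diag_mx (pairs x y)) 0 i) x y =
    A + B * (x ^+ 2 + y ^+ 2).
Proof.
move=> [p [pdeg phiE]].
pose ent (k : 'I_(4 * 4)) x y := mxvec (diag_mx (pairs x y)) 0 k.
have entE k : exists c a b, (a + b)%N = 1%N /\
    forall x y, ent k x y = c * x ^+ a * y ^+ b.
  rewrite /ent; case/mxvec_indexP: k => k l.
  have [<-|kl] := eqVneq k l; last first.
    exists 0, 1%N, 0%N; split=> // x y.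
    by rewrite mxvecE !mxE (negbTE kl) mulr0n !mul0r.
  case: k => -[|[|[|[|//]]]] hk.
  - exists 1, 1%N, 0%N; split=> // x y; rewrite mxvecE !mxE eqxx/=; ring.
  - exists (-1), 1%N, 0%N; split=> // x y; rewrite mxvecE !mxE eqxx/=; ring.
  - exists 1, 0%N, 1%N; split=> // x y; rewrite mxvecE !mxE eqxx/=; ring.
  - exists (-1), 0%N, 1%N; split=> // x y; rewrite mxvecE !mxE eqxx/=; ring.
have -> : (fun x y => phi (diag_mx (pairs x y)) 0 i) = fun x y =>
    \sum_(m <- msupp (p i)) mcoeff m (p i) * \prod_k ent k x y ^+ m k.
  by apply/funext => x; apply/funext => y; rewrite phiE ?mevalE//; exact: pairs_sl4.
have : {subset msupp (p i) <= msupp (p i)} by [].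
elim: {1 3}(msupp (p i)) => [_|m r IH sub].
  by exists 0, 0 => x y; rewrite /average !big_nil; ring.
have [|A [B AB]] := IH; first by move=> k kr; apply: sub; rewrite inE kr orbT.
have [k [a [b [ab kab]]]] := monomial_pairs (index_enum 'I_(4 * 4)) m entE.
have [|A' [B' AB']] := @average_monomial k a b.
  rewrite ab -mdegE; apply: (pdeg i); apply: sub; exact: mem_head.
exists (mcoeff m (p i) * A' + A), (mcoeff m (p i) * B' + B) => x y.
transitivity (mcoeff m (p i) * (A' + B' * (x ^+ 2 + y ^+ 2)) +
  (A + B * (x ^+ 2 + y ^+ 2))).
  rewrite -AB' -AB /average !big_cons !kab; ring.
ring.
Qed.
End pairs.

Lemma average_invariant (R : realType) (q : R -> R -> R) :
  (forall x y, x != 0 -> y != 0 -> x != y -> x != - y ->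
    [/\ q (- x) y = q x y, q x (- y) = q x y & q y x = q x y]) ->
  forall x y, x != 0 -> y != 0 -> x != y -> x != - y -> average q x y = 8 * q x y.
Proof.
move=> qinv x y x0 y0 xy xNy.
have [qNx qNy qyx] := qinv x y x0 y0 xy xNy.
have [||||qNxx qNxNy qyNx] := qinv (- x) y;
  rewrite ?oppr_eq0 ?eqr_opp ?eqr_oppLR ?opprK//.
have [||||_ _ qNyx] := qinv x (- y);
  rewrite ?oppr_eq0 ?eqr_opp ?eqr_oppLR ?opprK//.
have [||||_ _ qNyNx] := qinv (- x) (- y);
  rewrite ?oppr_eq0 ?eqr_opp ?eqr_oppLR ?opprK//.
by rewrite /average qNyNx qyNx qNyx qyx qNxNy qNx qNy; ring.
Qed.

Lemma pairs_symmetry (R : realType) (x y : R) :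
  [/\ exists s : 'S_4, pairs (- x) y = \row_i pairs x y 0 (s i),
      exists s : 'S_4, pairs x (- y) = \row_i pairs x y 0 (s i) &
      exists s : 'S_4, pairs y x = \row_i pairs x y 0 (s i)].
Proof.
pose i0 : 'I_4 := @Ordinal 4 0 isT; pose i1 : 'I_4 := @Ordinal 4 1 isT.
pose i2 : 'I_4 := @Ordinal 4 2 isT; pose i3 : 'I_4 := @Ordinal 4 3 isT.
split; [exists (tperm i0 i1)|exists (tperm i2 i3)|
        exists (tperm i0 i2 * tperm i1 i3)%g];
  apply/rowP => -[[|[|[|[|//]]]] hi]; rewrite !mxE ?permM !permE//= ?opprK//.
Qed.

Theorem theorem6p2 (R : realType) :
  ~ exists (n : nat) (rho : 'M[R]_4 -> 'M[R]_n) (phi : 'M[R]_4 -> 'rV[R]_n),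
      almost_separating_overalgebra 3 rho phi.
Proof.
move=> [n [rho [phi [rhoP [phi_poly _] phiP fin]]]].
pose reg (x y : R) := [/\ x != 0, y != 0, x != y & x != - y].
have inv x y : reg x y -> forall X, coad_orbit (diag_mx (pairs x y)) X ->
    phi X = phi (diag_mx (pairs x y)).
  move=> [x0 y0 xy xNy] X [g g1 <-].
  have p_inj := pairs_inj x0 y0 xy xNy.
  exact: (phi_invariant_diag rhoP phi_poly phiP (pairs_sl4 x y) p_inj).
pose q i x y := phi (diag_mx (pairs x y)) 0 i.
have symm x y : reg x y -> forall i, average (q i) x y = 8 * q i x y.
  move=> [x0 y0 xy xNy] i; apply: average_invariant => //.
  move=> u v u0 v0 uv uNv.
  have perm_inv (s : 'S_4) :
      phi (diag_mx (\row_i pairs u v 0 (s i))) = phi (diag_mx (pairs u v)).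
    by apply: inv => //; exact: diag_perm_orbit.
  have [[s1 e1] [s2 e2] [s3 e3]] := pairs_symmetry u v.
  by rewrite /q e1 e2 e3 !perm_inv.
(* x^2 = s k and y^2 = 1 - s k with s k < 1/2, so that 0 < x < y. *)
pose s k : R := k.+3%:R^-1.
pose xi k := diag_mx (pairs (Num.sqrt (s k)) (Num.sqrt (1 - s k))).
have s_gt0 k : 0 < s k by rewrite invr_gt0 ltr0n.
have s_lt k : s k < 1 - s k.
  have : 2 * s k < 1 by rewrite ltr_pdivrMr ?ltr0n// mul1r ltr_nat.
  lra.
have s_lt1 k : 0 < 1 - s k by exact: lt_trans (s_lt k).
have xi_reg k : reg (Num.sqrt (s k)) (Num.sqrt (1 - s k)).
  have sk : 0 < Num.sqrt (s k) by rewrite sqrtr_gt0.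
  have tk : Num.sqrt (s k) < Num.sqrt (1 - s k) by rewrite ltr_sqrt.
  split; [apply/lt0r_neq0; lra|apply/lt0r_neq0; lra| |]; apply/eqP => h; lra.
have xi_sl4 k : sl4 (xi k) by exact: pairs_sl4.
have xi_const k : phi (xi k) = phi (xi 0%N).
  apply/rowP => i.
  have [A [B AB]] := average_polynomial i phi_poly.
  have h l : 8 * phi (xi l) 0 i = A + B.
    by rewrite -/(q i _ _) -symm// AB !sqr_sqrtr ?ltW// [s l + _]addrC subrK mulr1.
  by have := h k; rewrite -(h 0%N); lra.
have hullE k : closed_convex_hull (overalgebra_map phi @` coad_orbit (xi k)) =
    closure [set Z : 'M[R]_4 * 'rV[R]_n | sl4 Z.1 /\ Z.2 = phi (xi 0%N)].
  have [x0 y0 xy xNy] := xi_reg k.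
  have p_inj := pairs_inj x0 y0 xy xNy.
  rewrite /closed_convex_hull.
  rewrite (hull_orbit (pairs_sl4 _ _) p_inj (f := phi (xi 0%N)))//.
  by move=> X /(inv _ _ (xi_reg k)) ->; exact: xi_const.
have orbit_inj : injective (fun k => coad_orbit (xi k)).
  move=> k l orbE.
  have : coad_orbit (xi k) (xi k).
    by exists 1%:M; [exact: SL4_1|rewrite invmx1 mul1mx mulmx1].
  rewrite orbE => -[g g1 /(congr1 determinant)].
  rewrite !det_mulmx (SL4V g1) g1 mul1r mulr1 !det_pairs !sqr_sqrtr ?ltW//.
  move=> detE; have sE : (s l - s k) * (1 - s l - s k) = 0 by lra.
  move/eqP: sE; rewrite mulf_eq0 => /orP[|] /eqP sE; last first.
    by exfalso; have := s_lt k; have := s_lt l; lra.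
  have /invr_inj/eqP : s k = s l by lra.
  by rewrite eqr_nat !eqSS => /eqP.
have genxi : generic (xi 0%N).
  have [x0 y0 xy xNy] := xi_reg 0%N.
  exact: (generic_diag (pairs_sl4 _ _) (pairs_inj x0 y0 xy xNy)).
apply: infinite_nat; apply: sub_finite_set
  (finite_preimage (f := fun k => coad_orbit (xi k)) _ (fin _ genxi)).
  move=> k _ /=; exists (xi k); first exact: xi_sl4.
  by split; [|rewrite !hullE].
by move=> k l _ _; exact: orbit_inj.
Qed.
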